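(* Let $A,B,C$ be analytic functions of $(t,x)$ with $A\ne0$. The nonlinear coupled system for $g^i=g^i(t,x)$, $i=1,2,3$, $$g^1_t-Ag^1_{xx}-Bg^1_x+\Bigl(2g^1_x-\tfrac{A_x}{A}g^1-\tfrac{A_t}{A}\Bigr)(g^1+B)+B_xg^1+2Ag^2_x+B_t=0,$$ $$g^2_t-Ag^2_{xx}-Bg^2_x+\Bigl(2g^1_x-\tfrac{A_x}{A}g^1-\tfrac{A_t}{A}\Bigr)(g^2-C)-C_xg^1-C_t=0,$$ $$g^3_t-Ag^3_{xx}-Bg^3_x+\Bigl(2g^1_x-\tfrac{A_x}{A}g^1-\tfrac{A_t}{A}\Bigr)g^3-Cg^3=0$$ is reduced by the transformation $$g^1=-A\frac{v^1v^2_{xx}-v^1_{xx}v^2}{v^1v^2_x-v^1_xv^2}-B,\qquad g^2=-A\frac{v^1_xv^2_{xx}-v^1_{xx}v^2_x}{v^1v^2_x-v^1_xv^2}+C,$$ $$g^3=\frac{A}{v^1v^2_x-v^1_xv^2}\begin{vmatrix}v^1&v^1_x&v^1_{xx}\\ v^2&v^2_x&v^2_{xx}\\ v^3&v^3_x&v^3_{xx}\end{vmatrix}$$ to the uncoupled system of three copies of the linear equation, $v^i_t-Av^i_{xx}-Bv^i_x-Cv^i=0$, $i=1,2,3$, for functions $v^i=v^i(t,x)$ with $v^1$ and $v^2$ linearly independent. That is, a triple $(g^1,g^2,g^3)$ satisfies the nonlinear system if and only if it is (locally) represented by these formulas with such $v^1,v^2,v^3$.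
   Context: All considerations are local: functions are smooth (or analytic) on a suitable domain, which may be shrunk so that expressions not vanishing identically do not vanish. Linearly independent solutions $v^1,v^2$ of $v_t=Av_{xx}+Bv_x+Cv$ have Wronskian $v^1v^2_x-v^1_xv^2$ that is not identically zero, so the formulas are well defined. *)

(* Defs.v *)
(* Stdlib reals with Coquelicot.  Functions of (t, x) are curried, t first. *)
From Stdlib Require Import Reals.
From Coquelicot Require Import Coquelicot.
Open Scope R_scope.

Definition dt (f : R -> R -> R) (t x : R) : R := Derive (fun s => f s x) t.
Definition dx (f : R -> R -> R) (t x : R) : R := Derive (fun y => f t y) x.

(* On an open set this is C^infinity: [ex_diff_n f n] asks that all iterated
   partial derivatives of f up to order n exist and are jointly continuous. *)
Definition smooth_on (D : R * R -> Prop) (f : R -> R -> R) : Prop :=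
  forall t x : R, D (t, x) -> forall n : nat, ex_diff_n f n t x.

(* Near (t, x), f is the sum of an absolutely convergent double power series
   in (h, k).  The double series is enumerated along the antidiagonals
   i + j = d, which is immaterial since convergence is absolute. *)
Definition analytic_at (f : R -> R -> R) (t x : R) : Prop :=
  exists (c : nat -> nat -> R) (r : R),
    0 < r /\
    forall h k : R, Rabs h < r -> Rabs k < r ->
      ex_series (fun d : nat =>
        sum_n (fun i => Rabs (c i (d - i)%nat * h ^ i * k ^ (d - i))) d) /\
      is_series (fun d : nat =>
        sum_n (fun i => c i (d - i)%nat * h ^ i * k ^ (d - i)) d)
        (f (t + h) (x + k)).

Definition analytic_on (D : R * R -> Prop) (f : R -> R -> R) : Prop :=
  forall t x : R, D (t, x) -> analytic_at f t x.

Definition linear_eq (A B C v : R -> R -> R) (t x : R) : Prop :=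
  dt v t x - A t x * dx (dx v) t x - B t x * dx v t x - C t x * v t x = 0.

(* The factor 2 g1_x - (A_x / A) g1 - A_t / A common to the three equations. *)
Definition coupling (A g1 : R -> R -> R) (t x : R) : R :=
  2 * dx g1 t x - dx A t x / A t x * g1 t x - dt A t x / A t x.

Definition nonlinear_system (A B C g1 g2 g3 : R -> R -> R) (t x : R) : Prop :=
  dt g1 t x - A t x * dx (dx g1) t x - B t x * dx g1 t x
    + coupling A g1 t x * (g1 t x + B t x)
    + dx B t x * g1 t x + 2 * A t x * dx g2 t x + dt B t x = 0
  /\
  dt g2 t x - A t x * dx (dx g2) t x - B t x * dx g2 t x
    + coupling A g1 t x * (g2 t x - C t x)
    - dx C t x * g1 t x - dt C t x = 0
  /\
  dt g3 t x - A t x * dx (dx g3) t x - B t x * dx g3 t x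
    + coupling A g1 t x * g3 t x - C t x * g3 t x = 0.

Definition lin_indep_on (D : R * R -> Prop) (v1 v2 : R -> R -> R) : Prop :=
  forall a b : R,
    (forall t x : R, D (t, x) -> a * v1 t x + b * v2 t x = 0) ->
    a = 0 /\ b = 0.

Definition wronskian (v1 v2 : R -> R -> R) (t x : R) : R :=
  v1 t x * dx v2 t x - dx v1 t x * v2 t x.

Definition det3 (a11 a12 a13 a21 a22 a23 a31 a32 a33 : R) : R :=
  a11 * (a22 * a33 - a23 * a32)
  - a12 * (a21 * a33 - a23 * a31)
  + a13 * (a21 * a32 - a22 * a31).

Definition transformation (A B C v1 v2 v3 g1 g2 g3 : R -> R -> R) (t x : R)
  : Prop :=
  g1 t x =
    - A t x * ((v1 t x * dx (dx v2) t x - dx (dx v1) t x * v2 t x)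
               / wronskian v1 v2 t x) - B t x
  /\
  g2 t x =
    - A t x * ((dx v1 t x * dx (dx v2) t x - dx (dx v1) t x * dx v2 t x)
               / wronskian v1 v2 t x) + C t x
  /\
  g3 t x =
    A t x / wronskian v1 v2 t x *
    det3 (v1 t x) (dx v1 t x) (dx (dx v1) t x)
         (v2 t x) (dx v2 t x) (dx (dx v2) t x)
         (v3 t x) (dx v3 t x) (dx (dx v3) t x).

(* Besides linear independence, the Wronskian is required not to vanish
   anywhere on U, so that no quotient in [transformation] is a division by the
   junk value [/ 0]: this is the usual local convention that the domain is
   shrunk until the denominators have no zeros. *)
Definition represented_on (U : R * R -> Prop)
    (A B C g1 g2 g3 : R -> R -> R) : Prop :=
  exists v1 v2 v3 : R -> R -> R,
    smooth_on U v1 /\ smooth_on U v2 /\ smooth_on U v3 /\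
    lin_indep_on U v1 v2 /\
    forall t x : R, U (t, x) ->
      wronskian v1 v2 t x <> 0 /\
      linear_eq A B C v1 t x /\
      linear_eq A B C v2 t x /\
      linear_eq A B C v3 t x /\
      transformation A B C v1 v2 v3 g1 g2 g3 t x.

Definition locally_represented (D : R * R -> Prop)
    (A B C g1 g2 g3 : R -> R -> R) : Prop :=
  forall p : R * R, D p ->
    exists U : R * R -> Prop,
      open U /\ U p /\ (forall q : R * R, U q -> D q) /\
      represented_on U A B C g1 g2 g3.

(* Main.v *)
(* Put L v = A v_xx + (g^1 + B) v_x - (g^2 - C) v.  Expanding
   the Wronskian of v^1, v^2, v along its last row shows that the transformation says
   exactly that L v^1 = L v^2 = 0 and L v^3 = g^3; combined with the linear equation this
   gives v_t = -g^1 v_x + g^2 v, with the extra term g^3 for v^3.  The integrability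
   condition of this pair of equations for v is E_1 v_x - E_2 v - E_3 = 0, where
   E_i is the left-hand side of the i-th nonlinear equation.  Given v^1, v^2, v^3,
   the nonvanishing Wronskian therefore forces E_1 = E_2 = E_3 = 0.  Conversely, when
   the E_i vanish, the pair is a completely integrable linear system for (v, v_x),
   so Frobenius' theorem gives v^1, v^2, v^3 with initial data at the given point for
   which the Wronskian is 1. *)
Require Import Defs.
From Stdlib Require Import Reals Lra Lia List ClassicalEpsilon.
From Coquelicot Require Import Coquelicot.
Open Scope R_scope.

(** * Calculus of smooth functions on an open set *)

(** The weight lies in the Frobenius step, because the solutions must be smooth in both variables
    jointly. No theorem on smooth dependence on parameters is invoked. Linearity permits explicit
    estimates on a box fixed in advance by a bound on the coefficients, and these give a first-order
    expansion in [t] whose remainder is quadratic in the increment. Once the first derivatives are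
    known to be affine expressions in the solution itself, all higher ones follow by induction.

    Smoothness means existence and continuity of all iterated partial derivatives, so the analytic
    coefficients are first shown to be smooth by differentiating their double series term by term.
    Both places rest on the same criterion: a remainder of at most [K * e ^ 2] yields a derivative.
    Convergence is measured throughout against [(1 / 2) ^ n], and radii and step sizes are chosen to
    produce this ratio.

    In the converse the integrability condition must hold for arbitrary values of v and v_x, not
    just along a known solution; this is what the vanishing of all three E_i provides. *)

Lemma open_locally_2d (D : R * R -> Prop) (t x : R) :
  open D -> D (t, x) -> locally_2d (fun s y => D (s, y)) t x.
Proof.
  intros HD Hp; apply locally_2d_locally.
  apply (locally_open D); auto.
  intros [s y]; auto.
Qed.

Lemma locally_2d_slice_t (P : R -> R -> Prop) (t x : R) :
  locally_2d P t x -> locally t (fun s => P s x).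
Proof.
  intros [d Hd]; exists d; intros s Hs; apply Hd; [exact Hs|].
  rewrite Rminus_diag, Rabs_R0; apply cond_pos.
Qed.

Lemma locally_2d_slice_x (P : R -> R -> Prop) (t x : R) :
  locally_2d P t x -> locally x (fun y => P t y).
Proof.
  intros [d Hd]; exists d; intros s Hs; apply Hd; [|exact Hs].
  rewrite Rminus_diag, Rabs_R0; apply cond_pos.
Qed.

(** Fixing the order makes induction possible: the derivative of a product or an inverse contains
    the function itself, to which the hypothesis at the lower order applies. *)
Definition diff_on (D : R * R -> Prop) (n : nat) (f : R -> R -> R) : Prop :=
  forall t x : R, D (t, x) -> ex_diff_n f n t x.

Lemma smooth_on_diff (D : R * R -> Prop) (f : R -> R -> R) :
  smooth_on D f <-> forall n, diff_on D n f.
Proof. split; intros H; [intros n t x Hp | intros t x Hp n]; apply H; auto. Qed.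

Lemma diff_on_continuity D n f t x :
  diff_on D n f -> D (t, x) -> continuity_2d_pt f t x.
Proof. intros H Hp; destruct n; apply (H t x Hp). Qed.

Lemma diff_on_pred D n f : diff_on D (S n) f -> diff_on D n f.
Proof. intros H t x Hp; apply (ex_diff_n_m (S n)); [lia | auto]. Qed.

Lemma diff_on_ext D n f g :
  open D -> (forall t x, D (t, x) -> f t x = g t x) ->
  diff_on D n f -> diff_on D n g.
Proof.
  intros HD E H t x Hp; apply ex_diff_n_ext_loc with f; auto.
  destruct (open_locally_2d D t x HD Hp) as [d Hd]; exists d; auto.
Qed.

(** Explicit candidates [ft] and [fx] stand in for [Derive]; since [D] is open they agree with it
    near each point, so their regularity transfers. *)
Lemma diff_on_S D n f ft fx :
  open D ->
  (forall t x, D (t, x) -> continuity_2d_pt f t x) ->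
  (forall t x, D (t, x) -> is_derive (fun s => f s x) t (ft t x)) ->
  (forall t x, D (t, x) -> is_derive (fun y => f t y) x (fx t x)) ->
  diff_on D n ft -> diff_on D n fx -> diff_on D (S n) f.
Proof.
  intros HD Hc Ht Hx Hft Hfx t x Hp; split; [auto|].
  split; [eexists; apply Ht; auto|].
  split; [eexists; apply Hx; auto|].
  split.
  - apply (diff_on_ext D n ft); auto.
    intros s y Hq; symmetry; apply is_derive_unique; auto.
  - apply (diff_on_ext D n fx); auto.
    intros s y Hq; symmetry; apply is_derive_unique; auto.
Qed.

Lemma diff_on_derive_t D n f t x :
  diff_on D (S n) f -> D (t, x) -> is_derive (fun s => f s x) t (dt f t x).
Proof. intros H Hp; apply Derive_correct; apply (H t x Hp). Qed.

Lemma diff_on_derive_x D n f t x :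
  diff_on D (S n) f -> D (t, x) -> is_derive (fun y => f t y) x (dx f t x).
Proof. intros H Hp; apply Derive_correct; apply (H t x Hp). Qed.

Lemma diff_on_dt D n f : diff_on D (S n) f -> diff_on D n (dt f).
Proof. intros H t x Hp; apply (H t x Hp). Qed.

Lemma diff_on_dx D n f : diff_on D (S n) f -> diff_on D n (dx f).
Proof. intros H t x Hp; apply (H t x Hp). Qed.

Lemma diff_on_const D n c : open D -> diff_on D n (fun _ _ => c).
Proof.
  intros HD; revert c; induction n; intros c.
  - intros t x Hp; split; [apply continuity_2d_pt_const | exact I].
  - apply (diff_on_S D n _ (fun _ _ => 0) (fun _ _ => 0)); auto;
      intros; try apply continuity_2d_pt_const;
      apply (is_derive_const c).
Qed.

Lemma diff_on_plus D n f g :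
  open D -> diff_on D n f -> diff_on D n g ->
  diff_on D n (fun t x => f t x + g t x).
Proof.
  intros HD; revert f g; induction n; intros f g Hf Hg.
  - intros t x Hp; split; [apply continuity_2d_pt_plus | exact I];
      eapply diff_on_continuity; eauto.
  - apply (diff_on_S D n _ (fun t x => dt f t x + dt g t x)
             (fun t x => dx f t x + dx g t x)); auto.
    + intros; apply continuity_2d_pt_plus; eapply diff_on_continuity; eauto.
    + intros t x Hp; apply (is_derive_plus (fun s => f s x) (fun s => g s x));
        eapply diff_on_derive_t; eauto.
    + intros t x Hp; apply (is_derive_plus (fun y => f t y) (fun y => g t y));
        eapply diff_on_derive_x; eauto.
    + apply IHn; apply diff_on_dt; auto.
    + apply IHn; apply diff_on_dx; auto.
Qed.

Lemma is_derive_Rmult (f g : R -> R) (x a b : R) :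
  is_derive f x a -> is_derive g x b ->
  is_derive (fun y => f y * g y) x (a * g x + f x * b).
Proof. intros Hf Hg; apply (is_derive_mult f g); auto; intros; apply Rmult_comm. Qed.

Lemma diff_on_mult D n f g :
  open D -> diff_on D n f -> diff_on D n g ->
  diff_on D n (fun t x => f t x * g t x).
Proof.
  intros HD; revert f g; induction n; intros f g Hf Hg.
  - intros t x Hp; split; [apply continuity_2d_pt_mult | exact I];
      eapply diff_on_continuity; eauto.
  - apply (diff_on_S D n _ (fun t x => dt f t x * g t x + f t x * dt g t x)
             (fun t x => dx f t x * g t x + f t x * dx g t x)); auto.
    + intros; apply continuity_2d_pt_mult; eapply diff_on_continuity; eauto.
    + intros t x Hp; apply (is_derive_Rmult (fun s => f s x) (fun s => g s x));
        eapply diff_on_derive_t; eauto.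
    + intros t x Hp; apply (is_derive_Rmult (fun y => f t y) (fun y => g t y));
        eapply diff_on_derive_x; eauto.
    + apply diff_on_plus; auto; apply IHn; auto using diff_on_dt, diff_on_pred.
    + apply diff_on_plus; auto; apply IHn; auto using diff_on_dx, diff_on_pred.
Qed.

Lemma diff_on_inv D n f :
  open D -> (forall t x, D (t, x) -> f t x <> 0) ->
  diff_on D n f -> diff_on D n (fun t x => / f t x).
Proof.
  intros HD H0; induction n; intros Hf.
  - intros t x Hp; split; [apply continuity_2d_pt_inv | exact I]; auto;
      eapply diff_on_continuity; eauto.
  (* The derivative of [/ f] contains the square of [/ f], which is covered at order [n] by the
     induction hypothesis. *)
  - assert (Hi : diff_on D n (fun t x => / f t x * / f t x)).
    { apply diff_on_mult; auto; apply IHn; auto using diff_on_pred. }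
    assert (H1 : diff_on D n (fun _ _ => -1)) by (apply diff_on_const; auto).
    apply (diff_on_S D n _
      (fun t x => -1 * (dt f t x * (/ f t x * / f t x)))
      (fun t x => -1 * (dx f t x * (/ f t x * / f t x)))); auto.
    + intros; apply continuity_2d_pt_inv; auto; eapply diff_on_continuity; eauto.
    + intros t x Hp.
      replace (-1 * _) with (- dt f t x / f t x ^ 2) by (field; auto).
      apply (is_derive_inv (fun s => f s x)); auto;
        eapply diff_on_derive_t; eauto.
    + intros t x Hp.
      replace (-1 * _) with (- dx f t x / f t x ^ 2) by (field; auto).
      apply (is_derive_inv (fun y => f t y)); auto;
        eapply diff_on_derive_x; eauto.
    + apply diff_on_mult; auto; apply diff_on_mult; auto using diff_on_dt.
    + apply diff_on_mult; auto; apply diff_on_mult; auto using diff_on_dx.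
Qed.

Lemma smooth_on_sub (D U : R * R -> Prop) f :
  (forall q, U q -> D q) -> smooth_on D f -> smooth_on U f.
Proof. intros H Hf t x Hp; apply Hf; auto. Qed.

Lemma smooth_on_ext D f g :
  open D -> (forall t x, D (t, x) -> f t x = g t x) ->
  smooth_on D f -> smooth_on D g.
Proof.
  rewrite !smooth_on_diff; intros HD E H n; apply diff_on_ext with f; auto.
Qed.

Lemma smooth_on_const D c : open D -> smooth_on D (fun _ _ => c).
Proof. rewrite smooth_on_diff; intros HD n; apply diff_on_const; auto. Qed.

Lemma smooth_on_plus D f g :
  open D -> smooth_on D f -> smooth_on D g ->
  smooth_on D (fun t x => f t x + g t x).
Proof. rewrite !smooth_on_diff; intros; apply diff_on_plus; auto. Qed.

Lemma smooth_on_mult D f g :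
  open D -> smooth_on D f -> smooth_on D g ->
  smooth_on D (fun t x => f t x * g t x).
Proof. rewrite !smooth_on_diff; intros; apply diff_on_mult; auto. Qed.

Lemma smooth_on_opp D f :
  open D -> smooth_on D f -> smooth_on D (fun t x => - f t x).
Proof.
  intros HD Hf; apply smooth_on_ext with (fun t x => -1 * f t x); auto.
  - intros; ring.
  - apply smooth_on_mult; auto; apply smooth_on_const; auto.
Qed.

Lemma smooth_on_minus D f g :
  open D -> smooth_on D f -> smooth_on D g ->
  smooth_on D (fun t x => f t x - g t x).
Proof.
  intros HD Hf Hg; apply smooth_on_plus; auto; apply smooth_on_opp; auto.
Qed.

Lemma smooth_on_div D f g :
  open D -> (forall t x, D (t, x) -> g t x <> 0) ->
  smooth_on D f -> smooth_on D g -> smooth_on D (fun t x => f t x / g t x).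
Proof.
  intros HD H0 Hf Hg; apply smooth_on_mult; auto.
  rewrite smooth_on_diff in *; intros; apply diff_on_inv; auto.
Qed.

Lemma smooth_on_dt D f : smooth_on D f -> smooth_on D (dt f).
Proof. rewrite !smooth_on_diff; intros H n; apply diff_on_dt; auto. Qed.

Lemma smooth_on_dx D f : smooth_on D f -> smooth_on D (dx f).
Proof. rewrite !smooth_on_diff; intros H n; apply diff_on_dx; auto. Qed.

Lemma smooth_on_continuity D f t x :
  smooth_on D f -> D (t, x) -> continuity_2d_pt f t x.
Proof. intros H Hp; apply (H t x Hp 0%nat). Qed.

Lemma smooth_on_derive_t D f t x :
  smooth_on D f -> D (t, x) -> is_derive (fun s => f s x) t (dt f t x).
Proof. rewrite smooth_on_diff; intros H; apply (diff_on_derive_t D 0); auto. Qed.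

Lemma smooth_on_derive_x D f t x :
  smooth_on D f -> D (t, x) -> is_derive (fun y => f t y) x (dx f t x).
Proof. rewrite smooth_on_diff; intros H; apply (diff_on_derive_x D 0); auto. Qed.

Lemma dt_ext_on D f g t x :
  open D -> D (t, x) -> (forall s y, D (s, y) -> f s y = g s y) ->
  dt f t x = dt g t x.
Proof.
  intros HD Hp E; apply Derive_ext_loc.
  apply (locally_2d_slice_t (fun s y => f s y = g s y)).
  destruct (open_locally_2d D t x HD Hp) as [d Hd]; exists d; auto.
Qed.

Lemma dx_ext_on D f g t x :
  open D -> D (t, x) -> (forall s y, D (s, y) -> f s y = g s y) ->
  dx f t x = dx g t x.
Proof.
  intros HD Hp E; apply Derive_ext_loc.
  apply (locally_2d_slice_x (fun s y => f s y = g s y)).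
  destruct (open_locally_2d D t x HD Hp) as [d Hd]; exists d; auto.
Qed.

Lemma dt_dx_comm D f t x :
  open D -> smooth_on D f -> D (t, x) -> dt (dx f) t x = dx (dt f) t x.
Proof.
  intros HD Hf Hp; apply (Schwarz f).
  - destruct (open_locally_2d D t x HD Hp) as [d Hd]; exists d.
    intros u v Hu Hv; assert (Hq := Hd u v Hu Hv).
    repeat split; eexists.
    + eapply smooth_on_derive_t; eauto.
    + eapply smooth_on_derive_x; eauto.
    + apply (smooth_on_derive_t D (dx f)); auto using smooth_on_dx.
    + apply (smooth_on_derive_x D (dt f)); auto using smooth_on_dt.
  - apply (smooth_on_continuity D (dt (dx f)));
      auto using smooth_on_dx, smooth_on_dt.
  - apply (smooth_on_continuity D (dx (dt f)));
      auto using smooth_on_dx, smooth_on_dt.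
Qed.

(** * Analytic functions are smooth *)

(** The criterion through which derivatives are obtained both for sums of series and for the
    [t]-direction in [frobenius]. *)
Lemma is_derive_quadratic (f : R -> R) (x l K d : R) :
  0 < d ->
  (forall e, Rabs e < d -> Rabs (f (x + e) - f x - e * l) <= K * e ^ 2) ->
  is_derive f x l.
Proof.
  intros Hd H; apply is_derive_Reals; intros eps Heps.
  (* The sign of [K] is not assumed; [Rabs K + 1] is a safe positive denominator. *)
  assert (HK : 0 < Rabs K + 1) by (pose proof (Rabs_pos K); lra).
  assert (Hm : 0 < Rmin d (eps / (Rabs K + 1))).
  { apply Rmin_pos; auto; apply Rdiv_lt_0_compat; auto. }
  exists (mkposreal _ Hm); simpl; intros e He0 He.
  assert (He1 := Rlt_le_trans _ _ _ He (Rmin_l _ _)).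
  assert (He2 := Rlt_le_trans _ _ _ He (Rmin_r _ _)).
  specialize (H e He1).
  replace ((f (x + e) - f x) / e - l) with ((f (x + e) - f x - e * l) / e)
    by (field; auto).
  assert (Hpe := Rabs_pos_lt e He0).
  unfold Rdiv; rewrite Rabs_mult, Rabs_inv.
  apply Rmult_lt_reg_r with (Rabs e); auto.
  rewrite Rmult_assoc, Rinv_l, Rmult_1_r by lra.
  apply Rle_lt_trans with (1 := H).
  rewrite <- (pow2_abs e).
  assert (Rabs e * (Rabs K + 1) < eps).
  { apply Rmult_lt_reg_r with (/ (Rabs K + 1)); [apply Rinv_0_lt_compat; auto|].
    rewrite Rmult_assoc, Rinv_r, Rmult_1_r by lra; exact He2. }
  pose proof (Rle_abs K).
  nra.
Qed.

Lemma MVT_bound (f df : R -> R) (x y M : R) :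
  (forall z, Rmin x y <= z <= Rmax x y -> is_derive f z (df z)) ->
  (forall z, Rmin x y <= z <= Rmax x y -> Rabs (df z) <= M) ->
  Rabs (f y - f x) <= M * Rabs (y - x).
Proof.
  intros Hd Hb.
  destruct (MVT_gen f x y df) as [c [Hc E]].
  - intros z Hz; apply Hd; lra.
  - intros z Hz; apply continuity_pt_filterlim.
    apply (ex_derive_continuous f); eexists; apply Hd; auto.
  - rewrite E, Rabs_mult; apply Rmult_le_compat_r; auto using Rabs_pos.
Qed.

Lemma Rmin_Rmax_abs_lt x y z r :
  Rabs x < r -> Rabs y < r -> Rmin x y <= z <= Rmax x y -> Rabs z < r.
Proof.
  intros Hx Hy Hz; apply Rabs_def2 in Hx; apply Rabs_def2 in Hy.
  unfold Rmin, Rmax in Hz; destruct (Rle_dec x y); apply Rabs_def1; lra.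
Qed.

Lemma is_series_half (K : R) : is_series (fun n => K * (1 / 2) ^ n) (2 * K).
Proof.
  replace (2 * K) with (K * / (1 - 1 / 2)) by field.
  apply (is_series_scal_l K (fun n => (1 / 2) ^ n)).
  apply is_series_geom; rewrite Rabs_pos_eq; lra.
Qed.

Lemma ex_series_half (a : nat -> R) (K : R) :
  (forall n, Rabs (a n) <= K * (1 / 2) ^ n) -> ex_series a.
Proof.
  intros H; apply (ex_series_le (K := R_AbsRing) (V := R_CompleteNormedModule)
                     a (fun n => K * (1 / 2) ^ n)); auto.
  eexists; apply is_series_half.
Qed.

Lemma Series_half_bound (a : nat -> R) (K : R) :
  (forall n, Rabs (a n) <= K * (1 / 2) ^ n) -> Rabs (Series a) <= 2 * K.
Proof.
  intros H.
  assert (HK : ex_series (fun n => K * (1 / 2) ^ n))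
    by (eexists; apply is_series_half).
  rewrite <- (is_series_unique _ _ (is_series_half K)).
  eapply Rle_trans; [apply Series_Rabs |].
  - apply (ex_series_half _ K); intros n; rewrite Rabs_Rabsolu; auto.
  - apply Series_le; auto; intros n; split; auto using Rabs_pos.
Qed.

(** Second derivatives bounded by a geometric sequence make the first-order remainders of the terms
    summable, with a sum quadratic in the increment. *)
Lemma is_derive_Series (f f1 f2 : nat -> R -> R) (r K x : R) :
  (forall n y, Rabs y < r -> is_derive (f n) y (f1 n y)) ->
  (forall n y, Rabs y < r -> is_derive (f1 n) y (f2 n y)) ->
  (forall n y, Rabs y < r -> Rabs (f n y) <= K * (1 / 2) ^ n) ->
  (forall n y, Rabs y < r -> Rabs (f1 n y) <= K * (1 / 2) ^ n) ->
  (forall n y, Rabs y < r -> Rabs (f2 n y) <= K * (1 / 2) ^ n) ->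
  Rabs x < r ->
  is_derive (fun y => Series (fun n => f n y)) x (Series (fun n => f1 n x)).
Proof.
  intros D1 D2 B0 B1 B2 Hx.
  apply is_derive_quadratic with (K := 2 * K) (d := r - Rabs x); [lra|].
  intros e He.
  assert (Hxe : Rabs (x + e) < r) by (pose proof (Rabs_triang x e); lra).
  assert (S0 := ex_series_half _ K (fun n => B0 n x Hx)).
  assert (S1 := ex_series_half _ K (fun n => B0 n _ Hxe)).
  assert (S2 := ex_series_half _ K (fun n => B1 n x Hx)).
  rewrite <- Series_minus, <- Series_scal_l, <- Series_minus; auto.
  2: apply (ex_series_minus (fun n => f n (x + e)) (fun n => f n x)); auto.
  2: apply (ex_series_scal_l e (fun n => f1 n x)); auto.
  rewrite Rmult_assoc; apply Series_half_bound.
  intros n.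
  (* The mean value theorem for [f n], then for [f1 n] between [x] and [c], bounds the remainder of
     the term by [K * (1 / 2) ^ n * e ^ 2]. *)
  destruct (MVT_gen (f n) x (x + e) (f1 n)) as [c [Hc E]].
  { intros z Hz; apply D1; apply (Rmin_Rmax_abs_lt x (x + e)); auto; lra. }
  { intros z Hz; apply continuity_pt_filterlim.
    apply (ex_derive_continuous (f n)); eexists; apply D1.
    apply (Rmin_Rmax_abs_lt x (x + e)); auto. }
  rewrite E.
  replace (f1 n c * (x + e - x) - e * f1 n x) with (e * (f1 n c - f1 n x)) by ring.
  rewrite Rabs_mult.
  assert (Hcr : Rabs c < r) by (apply (Rmin_Rmax_abs_lt x (x + e)); auto).
  assert (M := MVT_bound (f1 n) (f2 n) x c (K * (1 / 2) ^ n)).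
  assert (Hce : Rabs (c - x) <= Rabs e).
  { revert Hc; unfold Rmin, Rmax; destruct Rle_dec; intros Hc;
      apply Rabs_le; pose proof (Rle_abs e); pose proof (Rle_abs (- e));
      rewrite Rabs_Ropp in *; lra. }
  assert (HM : Rabs (f1 n c - f1 n x) <= K * (1 / 2) ^ n * Rabs (c - x)).
  { apply M; intros z Hz; [apply D2 | apply B2];
      apply (Rmin_Rmax_abs_lt x c); auto. }
  rewrite <- (pow2_abs e).
  assert (HKn : 0 <= K * (1 / 2) ^ n).
  { eapply Rle_trans; [apply Rabs_pos | apply (B0 n x Hx)]. }
  pose proof (Rabs_pos e).
  assert (K * (1 / 2) ^ n * Rabs (c - x) <= K * (1 / 2) ^ n * Rabs e)
    by (apply Rmult_le_compat_l; auto).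
  nra.
Qed.

(** * Double power series, summed by homogeneous parts *)

Definition hom (c : nat -> nat -> R) (d : nat) (h k : R) : R :=
  sum_n (fun i => c i (d - i)%nat * h ^ i * k ^ (d - i)) d.

Definition ps2 (c : nat -> nat -> R) (h k : R) : R :=
  Series (fun d => hom c d h k).

(** Cauchy estimates for the coefficients. They pass to formal derivatives with explicit constants,
    which a bare convergence hypothesis would not provide. *)
Definition geom_bounded (c : nat -> nat -> R) (M r : R) : Prop :=
  0 < r /\ forall i j, Rabs (c i j) * r ^ (i + j) <= M.

(** Differentiation lowers the degree by one: the derivative of the part of degree [d] is the part
    of degree [d - 1] of the derived series, and zero for [d = 0]. *)
Definition shift (a : nat -> R) (n : nat) : R :=
  match n with O => 0 | S m => a m end.

Definition coeff_t (c : nat -> nat -> R) (i j : nat) : R := INR (S i) * c (S i) j.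
Definition coeff_x (c : nat -> nat -> R) (i j : nat) : R := INR (S j) * c i (S j).

Lemma INR_S_le_pow2 n : INR (S n) <= 2 ^ n.
Proof.
  induction n; [simpl; lra|].
  rewrite S_INR; simpl pow.
  assert (1 <= 2 ^ n) by (apply pow_R1_Rle; lra). lra.
Qed.

Lemma geom_bounded_pos c M r : geom_bounded c M r -> 0 <= M.
Proof.
  intros [Hr H]; specialize (H 0%nat 0%nat); simpl in H.
  pose proof (Rabs_pos (c 0%nat 0%nat)); lra.
Qed.

(** A formal derivative multiplies a coefficient by [n + 1], at most [2 ^ m], and halving the radius
    absorbs this. The exponent [S m] comes from the raised index of that coefficient. *)
Lemma half_pow_bound r n m b M :
  0 < r -> 0 <= b -> (n <= m)%nat -> b * r ^ S m <= M ->
  INR (S n) * b * (r / 2) ^ m <= M / r.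
Proof.
  intros Hr Hb Hnm H.
  assert (H2 : INR (S n) <= 2 ^ m).
  { apply Rle_trans with (1 := INR_S_le_pow2 n); apply Rle_pow; auto; lra. }
  unfold Rdiv at 1; rewrite Rpow_mult_distr, pow_inv.
  apply Rmult_le_reg_r with r; auto.
  unfold Rdiv; rewrite (Rmult_assoc M), Rinv_l, Rmult_1_r by lra.
  apply Rle_trans with (2 := H).
  assert (0 < 2 ^ m) by (apply pow_lt; lra).
  assert (0 < r ^ m) by (apply pow_lt; lra).
  replace (INR (S n) * b * (r ^ m * / 2 ^ m) * r)
    with (INR (S n) * / 2 ^ m * (b * r ^ S m)) by (simpl; ring).
  rewrite <- (Rmult_1_l (b * r ^ S m)) at 2.
  apply Rmult_le_compat_r.
  - apply Rmult_le_pos; auto; apply pow_le; lra.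
  - apply Rmult_le_reg_r with (2 ^ m); auto.
    rewrite Rmult_assoc, Rinv_l by lra; lra.
Qed.

Lemma geom_bounded_t c M r :
  geom_bounded c M r -> geom_bounded (coeff_t c) (M / r) (r / 2).
Proof.
  intros [Hr H]; split; [lra|]; intros i j; unfold coeff_t.
  rewrite Rabs_mult, (Rabs_pos_eq (INR _)) by apply pos_INR.
  apply half_pow_bound; auto using Rabs_pos, Nat.le_add_r; apply (H (S i) j).
Qed.

Lemma geom_bounded_x c M r :
  geom_bounded c M r -> geom_bounded (coeff_x c) (M / r) (r / 2).
Proof.
  intros [Hr H]; split; [lra|]; intros i j; unfold coeff_x.
  rewrite Rabs_mult, (Rabs_pos_eq (INR _)) by apply pos_INR.
  apply half_pow_bound; auto using Rabs_pos; try lia.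
  replace (S (i + j)) with (i + S j)%nat by lia; apply H.
Qed.

Lemma sum_n_Rabs_le (a : nat -> R) (b : R) (n : nat) :
  (forall i, (i <= n)%nat -> Rabs (a i) <= b) ->
  Rabs (sum_n a n) <= INR (S n) * b.
Proof.
  induction n; intros H.
  - rewrite sum_O; simpl; specialize (H 0%nat (le_n _)); lra.
  - rewrite sum_Sn, S_INR; unfold plus; simpl.
    eapply Rle_trans; [apply Rabs_triang|].
    specialize (IHn (fun i Hi => H i (le_S _ _ Hi))).
    specialize (H (S n) (le_n _)); simpl in IHn; lra.
Qed.

(** There are [d + 1] terms, each at most [M * (m / r) ^ d]; the factor 2 in the ratio pays for
    [d + 1 <= 2 ^ d]. *)
Lemma hom_bound c M r d h k m :
  geom_bounded c M r -> Rabs h <= m -> Rabs k <= m ->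
  Rabs (hom c d h k) <= M * (2 * m / r) ^ d.
Proof.
  intros Hc Hh Hk; assert (HM := geom_bounded_pos _ _ _ Hc).
  destruct Hc as [Hr Hc].
  assert (Hm : 0 <= m) by (pose proof (Rabs_pos h); lra).
  apply Rle_trans with (INR (S d) * (M * (m / r) ^ d)).
  - apply sum_n_Rabs_le; intros i Hi.
    rewrite !Rabs_mult, <- !RPow_abs.
    specialize (Hc i (d - i)%nat).
    replace (i + (d - i))%nat with d in Hc by lia.
    apply Rle_trans with (Rabs (c i (d - i)%nat) * (m ^ i * m ^ (d - i))).
    { rewrite Rmult_assoc; apply Rmult_le_compat_l; [apply Rabs_pos|].
      apply Rmult_le_compat; try apply pow_le; try apply Rabs_pos;
        apply pow_incr; auto using Rabs_pos. }
    rewrite <- pow_add; replace (i + (d - i))%nat with d by lia.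
    unfold Rdiv; rewrite Rpow_mult_distr, pow_inv.
    assert (0 < r ^ d) by (apply pow_lt; lra).
    assert (0 <= m ^ d) by (apply pow_le; lra).
    replace (M * (m ^ d * / r ^ d)) with (M * / r ^ d * m ^ d) by ring.
    apply Rmult_le_compat_r; auto.
    apply Rmult_le_reg_r with (r ^ d); auto.
    rewrite Rmult_assoc, Rinv_l by lra; lra.
  - replace (2 * m / r) with (2 * (m / r)) by (field; lra).
    rewrite Rpow_mult_distr.
    assert (0 <= (m / r) ^ d).
    { apply pow_le; apply Rmult_le_pos; auto; apply Rlt_le, Rinv_0_lt_compat; auto. }
    pose proof (INR_S_le_pow2 d).
    assert (0 <= M * (m / r) ^ d) by (apply Rmult_le_pos; auto).
    nra.
Qed.

Lemma hom_half_bound c M r d h k :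
  geom_bounded c M r -> Rabs h <= r / 4 -> Rabs k <= r / 4 ->
  Rabs (hom c d h k) <= M * (1 / 2) ^ d.
Proof.
  intros Hc Hh Hk; assert (Hr := proj1 Hc).
  replace (1 / 2) with (2 * (r / 4) / r) by (field; lra).
  apply hom_bound; auto.
Qed.

Lemma is_derive_sum_n_R (F : nat -> R -> R) (F' : nat -> R) (x : R) n :
  (forall i, (i <= n)%nat -> is_derive (F i) x (F' i)) ->
  is_derive (fun y => sum_n (fun i => F i y) n) x (sum_n F' n).
Proof.
  induction n; intros H.
  - rewrite sum_O; apply is_derive_ext with (F 0%nat); auto.
    intros; rewrite sum_O; auto.
  - rewrite sum_Sn.
    apply is_derive_ext with (fun y => plus (sum_n (fun i => F i y) n) (F (S n) y)).
    + intros; rewrite sum_Sn; auto.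
    + apply (is_derive_plus (fun y => sum_n (fun i => F i y) n) (F (S n))); auto.
Qed.

Lemma is_derive_hom_t c d h k :
  is_derive (fun h => hom c d h k) h (shift (fun n => hom (coeff_t c) n h k) d).
Proof.
  assert (H : is_derive (fun h => hom c d h k) h
    (sum_n (fun i => c i (d - i)%nat * (INR i * h ^ pred i) * k ^ (d - i)) d)).
  { apply is_derive_sum_n_R; intros i Hi; auto_derive; auto; ring. }
  replace (shift _ _) with
    (sum_n (fun i => c i (d - i)%nat * (INR i * h ^ pred i) * k ^ (d - i)) d); auto.
  destruct d as [|d]; simpl shift.
  - rewrite sum_O; simpl; ring.
  (* The term [i = 0] does not depend on [h]; dropping it and lowering the index leaves the part of
     degree [d] of the derived series. *)
  - unfold sum_n; rewrite sum_Sn_m, <- sum_n_m_S by lia.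
    unfold plus; simpl AbelianMonoid.plus.
    change (INR 0) with 0; rewrite Rmult_0_l, Rmult_0_r, Rmult_0_l, Rplus_0_l.
    apply sum_n_m_ext_loc; intros i Hi; unfold coeff_t; simpl pred.
    replace (S d - S i)%nat with (d - i)%nat by lia.
    match goal with |- ?a = ?b => change (@eq R a b) end; simpl INR; ring.
Qed.

Lemma is_derive_hom_x c d h k :
  is_derive (fun k => hom c d h k) k (shift (fun n => hom (coeff_x c) n h k) d).
Proof.
  assert (H : is_derive (fun k => hom c d h k) k
    (sum_n (fun i => c i (d - i)%nat * h ^ i * (INR (d - i) * k ^ pred (d - i))) d)).
  { apply is_derive_sum_n_R; intros i Hi; auto_derive; auto; ring. }
  replace (shift _ _) with
    (sum_n (fun i => c i (d - i)%nat * h ^ i * (INR (d - i) * k ^ pred (d - i))) d);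
    auto.
  destruct d as [|d]; simpl shift.
  - rewrite sum_O; simpl; ring.
  (* Here the last term, [i = S d], is the one free of [k]. *)
  - rewrite sum_Sn; match goal with |- plus ?a ?b = ?e => change (a + b = e) end.
    rewrite Nat.sub_diag; change (INR 0) with 0.
    rewrite Rmult_0_l, Rmult_0_r, Rplus_0_r.
    apply sum_n_ext_loc; intros i Hi; unfold coeff_x.
    rewrite Nat.sub_succ_l by auto; simpl pred.
    match goal with |- ?a = ?b => change (@eq R a b) end; ring.
Qed.

Lemma is_derive_shift (a : nat -> R -> R) (a' : nat -> R) x n :
  (forall n, is_derive (a n) x (a' n)) ->
  is_derive (fun y => shift (fun n => a n y) n) x (shift a' n).
Proof.
  intros H; destruct n; simpl; [apply (is_derive_const 0) | apply H].
Qed.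

Lemma shift_bound (a : nat -> R) K n :
  0 <= K ->
  (forall n, Rabs (a n) <= K * (1 / 2) ^ n) ->
  Rabs (shift a n) <= 2 * K * (1 / 2) ^ n.
Proof.
  intros HK H; destruct n; simpl shift.
  - rewrite Rabs_R0; simpl; lra.
  - specialize (H n); simpl; lra.
Qed.

Lemma Series_shift (a : nat -> R) : ex_series a -> Series (shift a) = Series a.
Proof.
  intros H; rewrite Series_incr_1; [simpl; apply Rplus_0_l |].
  apply ex_series_incr_1; exact H.
Qed.

(** Two formal derivatives reduce the radius to [r / 4], and the ratio one half in [hom_half_bound]
    costs another factor 4, hence [r / 16]. Each [shift] doubles a bound, which explains the common
    constant [M + 2 * M1 + 4 * M2]. *)
Lemma is_derive_ps2_t c M r h k :
  geom_bounded c M r -> Rabs h < r / 16 -> Rabs k < r / 16 ->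
  is_derive (fun h => ps2 c h k) h (ps2 (coeff_t c) h k).
Proof.
  intros Hc Hh Hk; assert (Hr := proj1 Hc).
  assert (Hc1 := geom_bounded_t _ _ _ Hc); assert (Hc2 := geom_bounded_t _ _ _ Hc1).
  assert (HM := geom_bounded_pos _ _ _ Hc).
  assert (HM1 := geom_bounded_pos _ _ _ Hc1).
  assert (HM2 := geom_bounded_pos _ _ _ Hc2).
  set (M1 := M / r) in *; set (M2 := M1 / (r / 2)) in *.
  assert (B1 : forall n y, Rabs y < r / 16 ->
    Rabs (hom (coeff_t c) n y k) <= M1 * (1 / 2) ^ n).
  { intros; apply hom_half_bound with (r / 2); auto; lra. }
  assert (B2 : forall n y, Rabs y < r / 16 ->
    Rabs (hom (coeff_t (coeff_t c)) n y k) <= M2 * (1 / 2) ^ n).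
  { intros; apply hom_half_bound with (r / 2 / 2); auto; lra. }
  assert (Hpow : forall n, 0 <= (1 / 2) ^ n) by (intros; apply pow_le; lra).
  replace (ps2 (coeff_t c) h k)
    with (Series (shift (fun n => hom (coeff_t c) n h k))).
  2: { apply Series_shift; apply ex_series_half with M1; auto. }
  apply (is_derive_Series (fun n y => hom c n y k)
           (fun n y => shift (fun n => hom (coeff_t c) n y k) n)
           (fun n y => shift (shift (fun n => hom (coeff_t (coeff_t c)) n y k)) n)
           (r / 16) (M + 2 * M1 + 4 * M2)); auto.
  - intros; apply is_derive_hom_t.
  - intros; apply is_derive_shift; intros; apply is_derive_hom_t.
  - intros n y Hy; apply Rle_trans with (M * (1 / 2) ^ n).
    + apply hom_half_bound with r; auto; pose proof (Rabs_pos y); lra.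
    + apply Rmult_le_compat_r; auto; lra.
  - intros n y Hy; apply Rle_trans with (2 * M1 * (1 / 2) ^ n).
    + apply shift_bound; auto.
    + apply Rmult_le_compat_r; auto; lra.
  - intros n y Hy; apply Rle_trans with (2 * (2 * M2) * (1 / 2) ^ n).
    + apply shift_bound; [lra |]; intros; apply shift_bound; auto.
    + apply Rmult_le_compat_r; auto; lra.
Qed.

Lemma is_derive_ps2_x c M r h k :
  geom_bounded c M r -> Rabs h < r / 16 -> Rabs k < r / 16 ->
  is_derive (fun k => ps2 c h k) k (ps2 (coeff_x c) h k).
Proof.
  intros Hc Hh Hk; assert (Hr := proj1 Hc).
  assert (Hc1 := geom_bounded_x _ _ _ Hc); assert (Hc2 := geom_bounded_x _ _ _ Hc1).
  assert (HM := geom_bounded_pos _ _ _ Hc).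
  assert (HM1 := geom_bounded_pos _ _ _ Hc1).
  assert (HM2 := geom_bounded_pos _ _ _ Hc2).
  set (M1 := M / r) in *; set (M2 := M1 / (r / 2)) in *.
  assert (B1 : forall n y, Rabs y < r / 16 ->
    Rabs (hom (coeff_x c) n h y) <= M1 * (1 / 2) ^ n).
  { intros; apply hom_half_bound with (r / 2); auto; lra. }
  assert (B2 : forall n y, Rabs y < r / 16 ->
    Rabs (hom (coeff_x (coeff_x c)) n h y) <= M2 * (1 / 2) ^ n).
  { intros; apply hom_half_bound with (r / 2 / 2); auto; lra. }
  assert (Hpow : forall n, 0 <= (1 / 2) ^ n) by (intros; apply pow_le; lra).
  replace (ps2 (coeff_x c) h k)
    with (Series (shift (fun n => hom (coeff_x c) n h k))).
  2: { apply Series_shift; apply ex_series_half with M1; auto. }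
  apply (is_derive_Series (fun n y => hom c n h y)
           (fun n y => shift (fun n => hom (coeff_x c) n h y) n)
           (fun n y => shift (shift (fun n => hom (coeff_x (coeff_x c)) n h y)) n)
           (r / 16) (M + 2 * M1 + 4 * M2)); auto.
  - intros; apply is_derive_hom_x.
  - intros; apply is_derive_shift; intros; apply is_derive_hom_x.
  - intros n y Hy; apply Rle_trans with (M * (1 / 2) ^ n).
    + apply hom_half_bound with r; auto; pose proof (Rabs_pos y); lra.
    + apply Rmult_le_compat_r; auto; lra.
  - intros n y Hy; apply Rle_trans with (2 * M1 * (1 / 2) ^ n).
    + apply shift_bound; auto.
    + apply Rmult_le_compat_r; auto; lra.
  - intros n y Hy; apply Rle_trans with (2 * (2 * M2) * (1 / 2) ^ n).
    + apply shift_bound; [lra |]; intros; apply shift_bound; auto.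
    + apply Rmult_le_compat_r; auto; lra.
Qed.

(** Without the constant term every homogeneous part has a spare factor [2 * m / r]; for
    [m <= r / 4] the remaining powers sum to at most 2. *)
Lemma ps2_lipschitz_0 c M r h k m :
  geom_bounded c M r -> Rabs h <= m -> Rabs k <= m -> m <= r / 4 ->
  Rabs (ps2 c h k - c 0%nat 0%nat) <= 4 * M / r * m.
Proof.
  intros Hc Hh Hk Hmr; assert (Hr := proj1 Hc).
  assert (HM := geom_bounded_pos _ _ _ Hc).
  assert (Hm : 0 <= m) by (pose proof (Rabs_pos h); lra).
  assert (B : forall d, Rabs (hom c d h k) <= M * (1 / 2) ^ d).
  { intros; apply hom_half_bound with r; auto; lra. }
  unfold ps2; rewrite Series_incr_1 by (apply ex_series_half with M; auto).
  replace (hom c 0 h k) with (c 0%nat 0%nat)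
    by (unfold hom; rewrite sum_O; simpl; ring).
  match goal with |- Rabs ?a <= _ =>
    replace a with (Series (fun d => hom c (S d) h k)) by ring end.
  replace (4 * M / r * m) with (2 * (M * (2 * m / r))) by (field; lra).
  apply Series_half_bound; intros d.
  apply Rle_trans with (1 := hom_bound c M r (S d) h k m Hc Hh Hk).
  simpl pow; rewrite <- Rmult_assoc.
  assert (0 <= 2 * m / r).
  { apply Rmult_le_pos; [lra | apply Rlt_le, Rinv_0_lt_compat; auto]. }
  apply Rmult_le_compat_l; [apply Rmult_le_pos; auto|].
  apply pow_incr; split; auto.
  apply Rmult_le_reg_r with r; auto; unfold Rdiv.
  rewrite Rmult_assoc, Rinv_l by lra; lra.
Qed.

Lemma ps2_continuity f c M r d t x :
  geom_bounded c M r -> 0 < d ->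
  (forall h k, Rabs h < d -> Rabs k < d -> f (t + h) (x + k) = ps2 c h k) ->
  continuity_2d_pt f t x.
Proof.
  intros Hc Hd Hf; assert (Hr := proj1 Hc).
  assert (HM := geom_bounded_pos _ _ _ Hc).
  assert (HL : 0 < 4 * M / r + 1).
  { assert (0 <= 4 * M / r);
      [apply Rmult_le_pos; [lra | apply Rlt_le, Rinv_0_lt_compat; auto] | lra]. }
  intros eps.
  assert (Hm : 0 < Rmin d (Rmin (r / 4) (eps / (4 * M / r + 1)))).
  { repeat apply Rmin_pos; try lra; apply Rdiv_lt_0_compat; auto; apply cond_pos. }
  exists (mkposreal _ Hm); simpl; intros u v Hu Hv.
  assert (E0 : f t x = c 0%nat 0%nat).
  { replace (f t x) with (f (t + 0) (x + 0)) by (f_equal; ring).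
    rewrite Hf by (rewrite Rabs_R0; auto).
    apply Rminus_diag_uniq, Rabs_eq_0, Rle_antisym; [|apply Rabs_pos].
    replace 0 with (4 * M / r * 0) at 3 by ring.
    apply ps2_lipschitz_0; auto; try (rewrite Rabs_R0; lra); lra. }
  assert (Huv : f u v = ps2 c (u - t) (v - x)).
  { rewrite <- Hf; [f_equal; ring | |];
      (eapply Rlt_le_trans; [eassumption | apply Rmin_l]). }
  rewrite E0, Huv.
  set (m := Rmax (Rabs (u - t)) (Rabs (v - x))).
  assert (Hmm : m < Rmin d (Rmin (r / 4) (eps / (4 * M / r + 1))))
    by (apply Rmax_lub_lt; auto).
  assert (Hm1 : m < r / 4).
  { eapply Rlt_le_trans; [exact Hmm|].
    eapply Rle_trans; [apply Rmin_r | apply Rmin_l]. }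
  assert (Hm2 : m < eps / (4 * M / r + 1)).
  { eapply Rlt_le_trans; [exact Hmm|].
    eapply Rle_trans; [apply Rmin_r | apply Rmin_r]. }
  apply Rle_lt_trans with (4 * M / r * m).
  - apply ps2_lipschitz_0; auto; [apply Rmax_l | apply Rmax_r | lra].
  - assert (m * (4 * M / r + 1) < eps).
    { apply Rmult_lt_reg_r with (/ (4 * M / r + 1)).
      - apply Rinv_0_lt_compat; auto.
      - rewrite Rmult_assoc, Rinv_r, Rmult_1_r by lra; exact Hm2. }
    assert (0 <= m) by (eapply Rle_trans; [apply Rabs_pos | apply Rmax_l]).
    nra.
Qed.

(** The series is never expanded about another point: [ex_diff_n] asks for continuity at the centre
    only, and the partial derivatives of [f] are again sums of series about the same centre. The
    induction therefore ranges over all [f] and [c], with shrinking radii. *)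
Lemma ps2_ex_diff_n n : forall f c M r d t x,
  geom_bounded c M r -> 0 < d ->
  (forall h k, Rabs h < d -> Rabs k < d -> f (t + h) (x + k) = ps2 c h k) ->
  ex_diff_n f n t x.
Proof.
  induction n; intros f c M r d t x Hc Hd Hf; assert (Hr := proj1 Hc).
  all: assert (C := ps2_continuity f c M r d t x Hc Hd Hf).
  - split; auto.
  - set (d1 := Rmin d (r / 16)).
    assert (Hd1 : 0 < d1) by (apply Rmin_pos; lra).
    assert (L1 : d1 <= d) by apply Rmin_l.
    assert (L2 : d1 <= r / 16) by apply Rmin_r.
    assert (Near : forall a h, Rabs h < d1 -> locally (a + h) (fun s => Rabs (s - a) < d1)).
    { intros a h Hh; assert (Hp : 0 < d1 - Rabs h) by lra.
      exists (mkposreal _ Hp); intros s Hs.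
      unfold ball in Hs; simpl in Hs; unfold AbsRing_ball, abs, minus, plus, opp in Hs;
        simpl in Hs.
      replace (s - a) with ((s + - (a + h)) + h) by ring.
      eapply Rle_lt_trans; [apply Rabs_triang | lra]. }
    assert (Dt : forall h k, Rabs h < d1 -> Rabs k < d1 ->
      is_derive (fun s => f s (x + k)) (t + h) (ps2 (coeff_t c) h k)).
    { intros h k Hh Hk.
      apply is_derive_ext_loc with (fun s => ps2 c (s - t) k).
      - eapply filter_imp; [| apply (Near t h Hh)]; intros s Hs; simpl in Hs.
        rewrite <- Hf; try lra; f_equal; ring.
      - replace (ps2 (coeff_t c) h k) with (1 * ps2 (coeff_t c) h k) by ring.
        apply (is_derive_comp (fun h => ps2 c h k) (fun s => s - t)).
        + replace (t + h - t) with h by ring.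
          apply is_derive_ps2_t with M r; auto; lra.
        + auto_derive; auto; ring. }
    assert (Dx : forall h k, Rabs h < d1 -> Rabs k < d1 ->
      is_derive (fun y => f (t + h) y) (x + k) (ps2 (coeff_x c) h k)).
    { intros h k Hh Hk.
      apply is_derive_ext_loc with (fun y => ps2 c h (y - x)).
      - eapply filter_imp; [| apply (Near x k Hk)]; intros s Hs; simpl in Hs.
        rewrite <- Hf; try lra; f_equal; ring.
      - replace (ps2 (coeff_x c) h k) with (1 * ps2 (coeff_x c) h k) by ring.
        apply (is_derive_comp (fun k => ps2 c h k) (fun y => y - x)).
        + replace (x + k - x) with k by ring.
          apply is_derive_ps2_x with M r; auto; lra.
        + auto_derive; auto; ring. }
    assert (Z : Rabs 0 < d1) by (rewrite Rabs_R0; auto).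
    assert (Dt0 := Dt 0 0 Z Z); assert (Dx0 := Dx 0 0 Z Z).
    rewrite !Rplus_0_r in Dt0; rewrite !Rplus_0_r in Dx0.
    split; [exact C|].
    split; [eexists; exact Dt0|].
    split; [eexists; exact Dx0|].
    split.
    + apply (IHn _ (coeff_t c) (M / r) (r / 2) d1); auto using geom_bounded_t.
      intros h k Hh Hk; apply is_derive_unique, Dt; auto.
    + apply (IHn _ (coeff_x c) (M / r) (r / 2) d1); auto using geom_bounded_x.
      intros h k Hh Hk; apply is_derive_unique, Dx; auto.
Qed.

Lemma sum_n_term_le (a : nat -> R) i n :
  (forall j, 0 <= a j) -> (i <= n)%nat -> a i <= sum_n a n.
Proof.
  intros Ha; induction n; intros Hi.
  - replace i with 0%nat by lia; rewrite sum_O; lra.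
  - rewrite sum_Sn; unfold plus; simpl AbelianMonoid.plus.
    destruct (Nat.eq_dec i (S n)) as [->|].
    + assert (0 <= sum_n a n).
      { clear - Ha; induction n; [rewrite sum_O; auto|].
        rewrite sum_Sn; apply Rplus_le_le_0_compat; auto. }
      lra.
    + specialize (Ha (S n)); assert (a i <= sum_n a n) by (apply IHn; lia); lra.
Qed.

Lemma ex_series_bounded (a : nat -> R) :
  ex_series a -> exists M, forall n, Rabs (a n) <= M.
Proof.
  intros H; apply ex_series_lim_0 in H.
  destruct (filterlim_bounded a) as [M HM]; [exists 0; exact H|].
  exists M; exact HM.
Qed.

(** At [h = k = r / 2] the antidiagonal sums of absolute values form a convergent series, hence are
    bounded; each coefficient contributes one summand, and this is the Cauchy estimate with radius
    [r / 2]. *)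
Lemma analytic_at_ex_diff_n f t x n : analytic_at f t x -> ex_diff_n f n t x.
Proof.
  intros [c [r [Hr H]]].
  assert (Hh : Rabs (r / 2) < r) by (rewrite Rabs_pos_eq; lra).
  destruct (ex_series_bounded _ (proj1 (H _ _ Hh Hh))) as [M HM].
  apply (ps2_ex_diff_n n f c M (r / 2) r); auto.
  - split; [lra|]; intros i j; specialize (HM (i + j)%nat).
    eapply Rle_trans; [| exact HM].
    eapply Rle_trans; [| apply Rle_abs].
    eapply Rle_trans; [| apply (sum_n_term_le _ i); [intros; apply Rabs_pos | lia]].
    simpl; replace (i + j - i)%nat with j by lia.
    rewrite Rmult_assoc, <- pow_add, Rabs_mult, (Rabs_pos_eq ((r / 2) ^ _));
      [lra | apply pow_le; lra].
  - intros h k Hh' Hk'; symmetry; apply is_series_unique, H; auto.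
Qed.

Lemma analytic_on_smooth D f : analytic_on D f -> smooth_on D f.
Proof. intros H t x Hp n; apply analytic_at_ex_diff_n; auto. Qed.

(** * Linear ordinary differential equations *)

(** One row of an affine system in two unknowns. The unknowns are indexed by [bool] and the sum is
    written out, so that identities between rows fall to [ring]. *)
Definition aff (a : bool -> R) (c : R) (u : bool -> R) : R :=
  a true * u true + a false * u false + c.

Lemma aff_bound a c u M K :
  0 <= M -> (forall j, Rabs (a j) <= M) -> Rabs c <= K ->
  Rabs (aff a c u) <= M * (Rabs (u true) + Rabs (u false)) + K.
Proof.
  intros HM Ha Hc; unfold aff.
  eapply Rle_trans; [apply Rabs_triang|]; apply Rplus_le_compat; auto.
  eapply Rle_trans; [apply Rabs_triang|]; rewrite !Rabs_mult, Rmult_plus_distr_l.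
  apply Rplus_le_compat; apply Rmult_le_compat_r; auto using Rabs_pos.
Qed.

Lemma aff_minus a c u v :
  aff a c u - aff a c v = aff a 0 (fun j => u j - v j).
Proof. unfold aff; ring. Qed.

Lemma continuous_aff (a : bool -> R -> R) (c : R -> R) (u : bool -> R -> R) s :
  (forall j, continuous (a j) s) -> continuous c s ->
  (forall j, continuous (u j) s) ->
  continuous (fun s => aff (fun j => a j s) (c s) (fun j => u j s)) s.
Proof.
  intros Ha Hc Hu; unfold aff.
  apply (continuous_plus (V := R_NormedModule)
    (fun s => a true s * u true s + a false s * u false s) c); auto.
  apply (continuous_plus (V := R_NormedModule)
    (fun s => a true s * u true s) (fun s => a false s * u false s)).
  - apply (continuous_mult (K := R_AbsRing) (a true) (u true)); auto.
  - apply (continuous_mult (K := R_AbsRing) (a false) (u false)); auto.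
Qed.

(** * Limits with geometric error bounds *)

Lemma half_pow_small K eps : 0 < eps -> exists n, K * (1 / 2) ^ n < eps.
Proof.
  intros Heps; assert (HK : 0 < Rabs K + 1) by (pose proof (Rabs_pos K); lra).
  destruct (pow_lt_1_zero (1 / 2)) with (y := eps / (Rabs K + 1)) as [n Hn].
  - rewrite Rabs_pos_eq; lra.
  - apply Rdiv_lt_0_compat; auto.
  - exists n; specialize (Hn n (le_n n)).
    assert (Hp : 0 <= (1 / 2) ^ n) by (apply pow_le; lra).
    rewrite Rabs_pos_eq in Hn by auto.
    apply Rle_lt_trans with ((Rabs K + 1) * (1 / 2) ^ n).
    + apply Rmult_le_compat_r; auto; pose proof (Rle_abs K); lra.
    + apply Rmult_lt_reg_r with (/ (Rabs K + 1)); [apply Rinv_0_lt_compat; auto|].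
      replace ((Rabs K + 1) * (1 / 2) ^ n * / (Rabs K + 1)) with ((1 / 2) ^ n)
        by (field; lra); exact Hn.
Qed.

Lemma le_half_pow a b K : (forall n, a <= b + K * (1 / 2) ^ n) -> a <= b.
Proof.
  intros H; apply Rnot_lt_le; intros Hlt.
  destruct (half_pow_small K (a - b)) as [n Hn]; [lra|].
  specialize (H n); lra.
Qed.

(** The limit of [u] as a telescoping sum, which lets the bounds on [Series] supply the rate of
    convergence. *)
Definition tele_lim (u : nat -> R) : R := u O + Series (fun k => u (S k) - u k).

Lemma tele_lim_bound (u : nat -> R) K n :
  (forall n, Rabs (u (S n) - u n) <= K * (1 / 2) ^ n) ->
  Rabs (u n - tele_lim u) <= 2 * K * (1 / 2) ^ n.
Proof.
  intros H.
  (* The sum may be restarted at any index [m]; the induction peels off one increment at a time, and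
     the tail at [n] is the error sought. *)
  assert (E : forall m, Rabs (Series (fun k => u (S (m + k)) - u (m + k)%nat))
    <= 2 * (K * (1 / 2) ^ m) /\
    tele_lim u = u m + Series (fun k => u (S (m + k)) - u (m + k)%nat)).
  { assert (B : forall m k, Rabs (u (S (m + k)) - u (m + k)%nat)
        <= K * (1 / 2) ^ m * (1 / 2) ^ k).
    { intros; rewrite Rmult_assoc, <- pow_add; apply H. }
    intros m; split; [apply Series_half_bound; auto|].
    induction m; [reflexivity|].
    rewrite IHm, Series_incr_1 by (eapply ex_series_half; apply B).
    rewrite Nat.add_0_r, <- Rplus_assoc; f_equal; [ring|].
    apply Series_ext; intros k; rewrite <- Nat.add_succ_comm; reflexivity. }
  destruct (E n) as [B ->].
  rewrite Rabs_minus_sym, Rplus_minus_l; lra.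
Qed.

Lemma abs_between x0 x z :
  Rmin x0 x <= z <= Rmax x0 x -> Rabs (z - x0) <= Rabs (x - x0).
Proof.
  unfold Rmin, Rmax; destruct Rle_dec; intros H.
  - rewrite !Rabs_pos_eq; lra.
  - rewrite !Rabs_left1; lra.
Qed.

Lemma abs_between_lt s0 x y z d :
  Rabs (x - s0) < d -> Rabs (y - s0) < d ->
  Rmin x y <= z <= Rmax x y -> Rabs (z - s0) < d.
Proof.
  intros Hx Hy Hz; apply Rabs_def2 in Hx; apply Rabs_def2 in Hy.
  unfold Rmin, Rmax in Hz; destruct (Rle_dec x y); apply Rabs_def1; lra.
Qed.

Lemma uniform_limit_continuous (F : nat -> R -> R) (f : R -> R) s0 d K s :
  (forall n y, Rabs (y - s0) < d -> Rabs (F n y - f y) <= K * (1 / 2) ^ n) ->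
  (forall n, continuous (F n) s) -> Rabs (s - s0) < d -> continuous f s.
Proof.
  intros HF HC Hs; apply continuity_pt_filterlim, continuity_pt_locally.
  intros [eps Heps]; simpl.
  (* With [3 * K] each of the two uniform errors stays below a third of [eps]. *)
  destruct (half_pow_small (3 * K) eps Heps) as [n Hn].
  assert (Hc := proj2 (continuity_pt_filterlim (F n) s) (HC n)).
  assert (H3 : 0 < eps / 3) by lra.
  destruct (proj1 (continuity_pt_locally _ _) Hc (mkposreal _ H3)) as [r Hr].
  simpl in Hr.
  assert (Hp : 0 < Rmin r (d - Rabs (s - s0)))
    by (apply Rmin_pos; [apply cond_pos | lra]).
  exists (mkposreal _ Hp); intros y Hy.
  change (Rabs (y - s) < Rmin r (d - Rabs (s - s0))) in Hy.
  assert (Hy1 := Rlt_le_trans _ _ _ Hy (Rmin_l _ _)).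
  assert (Hy2 := Rlt_le_trans _ _ _ Hy (Rmin_r _ _)).
  assert (Hys : Rabs (y - s0) < d).
  { replace (y - s0) with ((y - s) + (s - s0)) by ring.
    eapply Rle_lt_trans; [apply Rabs_triang | lra]. }
  assert (A1 := HF n y Hys); assert (A2 := HF n s Hs); assert (A3 := Hr y Hy1).
  replace (f y - f s) with (- (F n y - f y) + (F n y - F n s) + (F n s - f s)) by ring.
  eapply Rle_lt_trans; [apply Rabs_triang|].
  eapply Rle_lt_trans; [apply Rplus_le_compat_r, Rabs_triang|].
  rewrite Rabs_Ropp; lra.
Qed.

(** The index offset matches Picard iteration, where the derivative of iterate [S n] is the
    right-hand side evaluated at iterate [n]. The mean value theorem is applied to the iterates and
    only the resulting inequality is passed to the limit. *)
Lemma uniform_limit_derive (F G : nat -> R -> R) (f g : R -> R) s0 d K s :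
  (forall n y, is_derive (F (S n)) y (G n y)) ->
  (forall n y, Rabs (y - s0) < d -> Rabs (F n y - f y) <= K * (1 / 2) ^ n) ->
  (forall n y, Rabs (y - s0) < d -> Rabs (G n y - g y) <= K * (1 / 2) ^ n) ->
  continuous g s -> Rabs (s - s0) < d -> is_derive f s (g s).
Proof.
  intros HD HF HG Hg Hs; apply is_derive_Reals; intros eps Heps.
  assert (Hc := proj2 (continuity_pt_filterlim g s) Hg).
  assert (H2 : 0 < eps / 2) by lra.
  destruct (proj1 (continuity_pt_locally _ _) Hc (mkposreal _ H2)) as [r Hr].
  simpl in Hr.
  assert (Hp : 0 < Rmin r (d - Rabs (s - s0)))
    by (apply Rmin_pos; [apply cond_pos | lra]).
  exists (mkposreal _ Hp); simpl; intros e He0 He.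
  assert (He1 := Rlt_le_trans _ _ _ He (Rmin_l _ _)).
  assert (He2 := Rlt_le_trans _ _ _ He (Rmin_r _ _)).
  assert (Hse : Rabs (s + e - s0) < d).
  { replace (s + e - s0) with ((s - s0) + e) by ring.
    eapply Rle_lt_trans; [apply Rabs_triang | lra]. }
  assert (Hpe := Rabs_pos_lt e He0).
  assert (B : Rabs (f (s + e) - f s - g s * e) <= eps / 2 * Rabs e).
  (* One [K] for the error of the iterate at each end of the increment, and [K * Rabs e] for the
     error of its derivative. *)
  { apply le_half_pow with (K := K + K + K * Rabs e); intros n.
    assert (MV : Rabs ((F (S n) (s + e) - g s * (s + e)) - (F (S n) s - g s * s))
        <= (eps / 2 + K * (1 / 2) ^ n) * Rabs (s + e - s)).
    { apply (MVT_bound (fun y => F (S n) y - g s * y) (fun y => G n y - g s)).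
      - intros z _; apply (is_derive_minus (F (S n)) (fun y => g s * y)); auto.
        auto_derive; auto; ring.
      - intros z Hz.
        assert (Hzs := abs_between _ _ _ Hz).
        replace (s + e - s) with e in Hzs by ring.
        assert (Hz0 : Rabs (z - s0) < d) by (apply (abs_between_lt s0 s (s + e)); auto).
        assert (A1 := HG n z Hz0).
        assert (A2 := Hr z (Rle_lt_trans _ _ _ Hzs He1)).
        replace (G n z - g s) with ((g z - g s) + (G n z - g z)) by ring.
        eapply Rle_trans; [apply Rabs_triang | lra]. }
    replace (s + e - s) with e in MV by ring.
    assert (A1 := HF (S n) _ Hse); assert (A2 := HF (S n) _ Hs); simpl pow in A1, A2.
    assert (0 <= K * (1 / 2) ^ n).
    { eapply Rle_trans; [apply Rabs_pos | apply (HF n s Hs)]. }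
    replace (f (s + e) - f s - g s * e) with
      (- (F (S n) (s + e) - f (s + e)) + (F (S n) s - f s)
       + ((F (S n) (s + e) - g s * (s + e)) - (F (S n) s - g s * s))) by ring.
    eapply Rle_trans; [apply Rabs_triang|].
    eapply Rle_trans; [apply Rplus_le_compat_r, Rabs_triang|].
    rewrite Rabs_Ropp; lra. }
  replace ((f (s + e) - f s) / e - g s) with ((f (s + e) - f s - g s * e) * / e)
    by (field; auto).
  rewrite Rabs_mult, Rabs_inv.
  apply Rmult_lt_reg_r with (Rabs e); auto.
  rewrite Rmult_assoc, Rinv_l, Rmult_1_r by lra.
  assert (0 < eps * Rabs e) by (apply Rmult_lt_0_compat; auto); lra.
Qed.

Fixpoint picard (a : bool -> bool -> R -> R) (c : bool -> R -> R) (s0 : R)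
    (u0 : bool -> R) (n : nat) (i : bool) (s : R) : R :=
  match n with
  | O => u0 i
  | S m => u0 i + RInt (fun r => aff (fun j => a i j r) (c i r)
                                   (fun j => picard a c s0 u0 m j r)) s0 s
  end.

(** Picard iteration. A step multiplies the difference of successive iterates by at most
    [2 * M * d], the 2 counting the unknowns, so [4 * M * d <= 1] gives the ratio one half.
    Continuity of the coefficients on the whole line makes all iterates differentiable
    everywhere. *)
Lemma linear_ode_global (a : bool -> bool -> R -> R) (c : bool -> R -> R)
    (s0 d M : R) (u0 : bool -> R) :
  0 < d -> 0 <= M -> 4 * M * d <= 1 ->
  (forall i j s, continuous (a i j) s) -> (forall i s, continuous (c i) s) ->
  (forall i j s, Rabs (a i j s) <= M) -> (forall i s, Rabs (c i s) <= M) ->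
  exists y : bool -> R -> R,
    (forall i, y i s0 = u0 i) /\
    forall i s, Rabs (s - s0) < d ->
      is_derive (y i) s (aff (fun j => a i j s) (c i s) (fun j => y j s)).
Proof.
  intros Hd HM HMd Ca Cc Ba Bc.
  set (Y := picard a c s0 u0).
  set (G := fun n i s => aff (fun j => a i j s) (c i s) (fun j => Y n j s)).
  assert (HR : forall (f : R -> R) s, (forall y, continuous f y) ->
    is_derive (fun s => RInt f s0 s) s (f s)).
  { intros f s Hf; apply (is_derive_RInt f _ s0); auto.
    apply filter_forall; intros y; apply (RInt_correct f).
    apply (ex_RInt_continuous f); auto. }
  assert (CY : forall n i s, continuous (Y n i) s).
  { induction n; intros i s.
    - apply continuous_const.
    - apply (ex_derive_continuous (Y (S n) i)).
      eexists; apply (is_derive_plus (fun _ => u0 i)); [apply is_derive_const|].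
      apply HR; intros; apply continuous_aff; auto. }
  assert (DY : forall n i s, is_derive (Y (S n) i) s (G n i s)).
  { intros n i s; replace (G n i s) with (plus 0 (G n i s))
      by apply Rplus_0_l.
    apply (is_derive_plus (fun _ => u0 i)); [apply (is_derive_const (u0 i))|].
    apply (HR (fun r => aff (fun j => a i j r) (c i r) (fun j => Y n j r))).
    intros; apply continuous_aff; auto. }
  assert (Y0 : forall n i, Y n i s0 = u0 i).
  { intros [|n] i; [reflexivity|].
    unfold Y; cbn [picard]; rewrite RInt_point; apply Rplus_0_r. }
  (* Size of the first step, from the constant iterate [u0]. *)
  set (K := M * (Rabs (u0 true) + Rabs (u0 false)) * d + M * d).
  assert (HS : forall n i s, Rabs (s - s0) < d ->
    Rabs (Y (S n) i s - Y n i s) <= K * (1 / 2) ^ n).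
  { induction n; intros i s Hs.
    - assert (MV := MVT_bound (Y 1%nat i) (G 0%nat i) s0 s
        (M * (Rabs (u0 true) + Rabs (u0 false)) + M)).
      rewrite Y0 in MV; change (Y 0%nat i s) with (u0 i).
      eapply Rle_trans; [apply MV; intros; [apply DY | apply aff_bound; auto] |].
      unfold K; simpl; rewrite Rmult_1_r, <- Rmult_plus_distr_r.
      apply Rmult_le_compat_l; [| lra].
      pose proof (Rabs_pos (u0 true)); pose proof (Rabs_pos (u0 false)); nra.
    - assert (MV := MVT_bound (fun s => Y (S (S n)) i s - Y (S n) i s)
        (fun s => G (S n) i s - G n i s) s0 s
        (M * (K * (1 / 2) ^ n + K * (1 / 2) ^ n) + 0)).
      cbv beta in MV; rewrite !Y0, Rminus_diag, Rminus_0_r in MV.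
      eapply Rle_trans; [apply MV |].
      + intros; apply (is_derive_minus (Y (S (S n)) i) (Y (S n) i)); apply DY.
      + intros z Hz; unfold G; rewrite aff_minus.
        assert (Hz0 : Rabs (z - s0) < d)
          by (apply Rle_lt_trans with (2 := Hs), abs_between, Hz).
        eapply Rle_trans; [apply (aff_bound _ 0 _ M 0); auto;
          rewrite Rabs_R0; lra |].
        apply Rplus_le_compat_r, Rmult_le_compat_l; auto.
        apply Rplus_le_compat; apply IHn; auto.
      + assert (0 <= K * (1 / 2) ^ n)
          by (eapply Rle_trans; [apply Rabs_pos | apply (IHn i s Hs)]).
        simpl pow; pose proof (Rabs_pos (s - s0)).
        assert (M * Rabs (s - s0) <= 1 / 4) by nra.
        set (X := K * (1 / 2) ^ n) in *.
        replace ((M * (X + X) + 0) * Rabs (s - s0))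
          with (M * Rabs (s - s0) * (2 * X)) by ring.
        replace (K * (1 / 2 * (1 / 2) ^ n)) with (1 / 4 * (2 * X))
          by (unfold X; field).
        apply Rmult_le_compat_r; lra. }
  set (y := fun i s => tele_lim (fun n => Y n i s)).
  assert (HL : forall n i s, Rabs (s - s0) < d ->
    Rabs (Y n i s - y i s) <= 2 * K * (1 / 2) ^ n).
  { intros n i s Hs; apply (tele_lim_bound (fun n => Y n i s)); auto. }
  exists y; split.
  - intros i; apply Rminus_diag_uniq, Rabs_eq_0, Rle_antisym; [|apply Rabs_pos].
    apply le_half_pow with (2 * K); intros n; rewrite Rplus_0_l.
    rewrite <- (Y0 n i), Rabs_minus_sym; apply HL.
    rewrite Rminus_diag, Rabs_R0; auto.
  - intros i s Hs.
    assert (Cy : forall j, continuous (y j) s).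
    { intros j; apply (uniform_limit_continuous (fun n => Y n j) _ s0 d (2 * K)); auto. }
    assert (HK : 0 <= 2 * K).
    { apply Rle_trans with (2 * K * (1 / 2) ^ 0); [| simpl; lra].
      eapply Rle_trans; [apply Rabs_pos | apply (HL 0%nat i s Hs)]. }
    apply (uniform_limit_derive (fun n => Y n i) (fun n => G n i) (y i)
      (fun s => aff (fun j => a i j s) (c i s) (fun j => y j s))
      s0 d (2 * K + 2 * M * (2 * K))); auto.
    + intros n z Hz; apply Rle_trans with (1 := HL n i z Hz).
      apply Rmult_le_compat_r; [apply pow_le; lra|].
      assert (0 <= M * (2 * K)) by (apply Rmult_le_pos; auto); lra.
    + intros n z Hz; unfold G; rewrite aff_minus.
      eapply Rle_trans; [apply (aff_bound _ 0 _ M 0); auto; rewrite Rabs_R0; lra|].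
      assert (A1 := HL n true z Hz); assert (A2 := HL n false z Hz).
      assert (0 <= (1 / 2) ^ n) by (apply pow_le; lra).
      assert (0 <= 2 * K * (1 / 2) ^ n) by (apply Rmult_le_pos; auto).
      assert (M * (Rabs (Y n true z - y true z) + Rabs (Y n false z - y false z))
        <= M * (2 * K * (1 / 2) ^ n + 2 * K * (1 / 2) ^ n))
        by (apply Rmult_le_compat_l; lra).
      lra.
    + apply continuous_aff; auto.
Qed.

(** Retraction onto a closed interval. Precomposing with it extends locally given coefficients to
    globally continuous and bounded ones without changing them on the interval. *)
Definition clamp (s0 d s : R) : R := Rmax (s0 - d) (Rmin (s0 + d) s).

Lemma clamp_id s0 d s : Rabs (s - s0) <= d -> clamp s0 d s = s.
Proof.
  intros H; apply Rabs_le_between in H; unfold clamp.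
  rewrite Rmin_right, Rmax_right; lra.
Qed.

Lemma clamp_bound s0 d s : 0 <= d -> Rabs (clamp s0 d s - s0) <= d.
Proof.
  intros Hd; apply Rabs_le; unfold clamp.
  unfold Rmin, Rmax; repeat destruct Rle_dec; lra.
Qed.

Lemma clamp_continuous s0 d s : continuous (clamp s0 d) s.
Proof.
  apply continuity_pt_filterlim, continuity_pt_locally; intros eps; exists eps.
  intros y Hy; change (Rabs (y - s) < eps) in Hy.
  apply Rle_lt_trans with (2 := Hy).
  unfold clamp, Rmin, Rmax; repeat destruct Rle_dec;
    unfold Rabs; repeat destruct Rcase_abs; lra.
Qed.

Lemma linear_ode (a : bool -> bool -> R -> R) (c : bool -> R -> R)
    (s0 d r M : R) (u0 : bool -> R) :
  0 < d < r -> 0 <= M -> 4 * M * d <= 1 ->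
  (forall i j s, Rabs (s - s0) < r -> continuous (a i j) s) ->
  (forall i s, Rabs (s - s0) < r -> continuous (c i) s) ->
  (forall i j s, Rabs (s - s0) < r -> Rabs (a i j s) <= M) ->
  (forall i s, Rabs (s - s0) < r -> Rabs (c i s) <= M) ->
  exists y : bool -> R -> R,
    (forall i, y i s0 = u0 i) /\
    forall i s, Rabs (s - s0) < d ->
      is_derive (y i) s (aff (fun j => a i j s) (c i s) (fun j => y j s)).
Proof.
  intros Hd HM HMd Ca Cc Ba Bc.
  assert (Hcl : forall s, Rabs (clamp s0 d s - s0) < r)
    by (intros s; pose proof (clamp_bound s0 d s); lra).
  destruct (linear_ode_global (fun i j s => a i j (clamp s0 d s))
    (fun i s => c i (clamp s0 d s)) s0 d M u0) as [y [H0 H1]]; auto; try lra.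
  - intros i j s; apply (continuous_comp (clamp s0 d) (a i j));
      auto using clamp_continuous.
  - intros i s; apply (continuous_comp (clamp s0 d) (c i));
      auto using clamp_continuous.
  - exists y; split; auto; intros i s Hs; specialize (H1 i s Hs).
    rewrite clamp_id in H1 by lra; exact H1.
Qed.

(** A substitute for the Gronwall inequality on short intervals. At a point [m] where
    [S = |z true| + |z false|] is maximal, the mean value theorem gives [S m <= 2 * zeta + 2 * r *
    (M * S m + rho)], and [4 * M * r <= 1] lets half of [S m] be absorbed on the left. *)
Lemma linear_estimate (z dz : bool -> R -> R) (x0 x M rho zeta : R) :
  0 <= M -> 0 <= rho -> 4 * M * Rabs (x - x0) <= 1 ->
  (forall i y, Rabs (y - x0) <= Rabs (x - x0) -> is_derive (z i) y (dz i y)) ->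
  (forall i y, Rabs (y - x0) <= Rabs (x - x0) ->
     Rabs (dz i y) <= M * (Rabs (z true y) + Rabs (z false y)) + rho) ->
  (forall i, Rabs (z i x0) <= zeta) ->
  forall i, Rabs (z i x) <= 4 * zeta + 4 * Rabs (x - x0) * rho.
Proof.
  intros HM Hrho Hsm Hd Hb H0.
  set (r := Rabs (x - x0)) in *.
  assert (Hr : 0 <= r) by apply Rabs_pos.
  set (S := fun y => Rabs (z true y) + Rabs (z false y)).
  assert (Hin : forall y, x0 - r <= y <= x0 + r -> Rabs (y - x0) <= r)
    by (intros; apply Rabs_le; lra).
  destruct (continuity_ab_maj S (x0 - r) (x0 + r)) as [m [Hm Hmr]]; [lra | |].
  { intros y Hy; apply continuity_pt_plus;
      apply (continuity_pt_comp (z _) Rabs); try apply Rcontinuity_abs;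
      apply continuity_pt_filterlim; apply (ex_derive_continuous (z _));
      eexists; apply Hd; auto. }
  assert (HSm : 0 <= S m)
    by (unfold S; pose proof (Rabs_pos (z true m)); pose proof (Rabs_pos (z false m)); lra).
  assert (E : forall i, Rabs (z i m) <= zeta + (M * S m + rho) * r).
  { intros i; assert (MV := MVT_bound (z i) (dz i) x0 m (M * S m + rho)).
    assert (Hmm := Hin m Hmr).
    assert (Hz : forall y, Rmin x0 m <= y <= Rmax x0 m -> Rabs (y - x0) <= r)
      by (intros y Hy; apply Rle_trans with (2 := Hmm), abs_between, Hy).
    assert (MV' : Rabs (z i m - z i x0) <= (M * S m + rho) * Rabs (m - x0)).
    { apply MV; intros y Hy; [apply Hd; auto|].
      eapply Rle_trans; [apply Hb; auto|].
      apply Rplus_le_compat_r, Rmult_le_compat_l; auto.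
      apply Hm; specialize (Hz y Hy); apply Rabs_le_between in Hz; lra. }
    assert (0 <= M * S m) by (apply Rmult_le_pos; auto).
    assert ((M * S m + rho) * Rabs (m - x0) <= (M * S m + rho) * r)
      by (apply Rmult_le_compat_l; lra).
    replace (z i m) with (z i x0 + (z i m - z i x0)) by ring.
    eapply Rle_trans; [apply Rabs_triang|].
    specialize (H0 i); lra. }
  assert (HS : S m <= 4 * zeta + 4 * r * rho).
  { assert (A1 := E true); assert (A2 := E false).
    assert (S m <= 2 * (zeta + (M * S m + rho) * r)) by (unfold S at 1; lra).
    assert (4 * M * r * S m <= 1 * S m) by (apply Rmult_le_compat_r; auto).
    lra. }
  intros i; apply Rle_trans with (2 := HS).
  apply Rle_trans with (S x).
  - unfold S; pose proof (Rabs_pos (z true x)); pose proof (Rabs_pos (z false x)).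
    destruct i; lra.
  - apply Hm; pose proof (proj1 (Rabs_le_between (x - x0) r) (Rle_refl r)); lra.
Qed.

(** * Quadratic remainders, local bounds and open boxes *)

Lemma quadratic_bound (f f1 : R -> R) K t s :
  (forall z, Rmin t s <= z <= Rmax t s -> is_derive f z (f1 z)) ->
  (forall z, Rmin t s <= z <= Rmax t s -> Rabs (f1 z - f1 t) <= K * Rabs (z - t)) ->
  Rabs (f s - f t - (s - t) * f1 t) <= K * (s - t) ^ 2.
Proof.
  intros D1 B.
  destruct (Req_dec s t) as [->|Hne].
  { rewrite !Rminus_diag, Rmult_0_l, Rminus_diag, Rabs_R0; simpl; lra. }
  assert (Hst : 0 < Rabs (s - t)) by (apply Rabs_pos_lt; lra).
  assert (HK : 0 <= K).
  { assert (A : 0 <= K * Rabs (s - t)).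
    { eapply Rle_trans; [apply Rabs_pos | apply B].
      split; [apply Rmin_r | apply Rmax_r]. }
    apply Rnot_lt_le; intros HK; nra. }
  (* Only the deviation of [f1] from its value at [t] enters. The bound thus applies to [w] in
     [frobenius], whose derivative is merely shown to be Lipschitz. *)
  assert (MV : Rabs ((f s - f1 t * s) - (f t - f1 t * t))
      <= (K * Rabs (s - t)) * Rabs (s - t)).
  { apply (MVT_bound (fun y => f y - f1 t * y) (fun y => f1 y - f1 t)).
    - intros z Hz; apply (is_derive_minus f (fun y => f1 t * y)); auto.
      auto_derive; auto; ring.
    - intros z Hz; apply Rle_trans with (1 := B z Hz).
      apply Rmult_le_compat_l; auto; apply abs_between; auto. }
  replace (f s - f t - (s - t) * f1 t)
    with ((f s - f1 t * s) - (f t - f1 t * t)) by ring.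
  rewrite <- (pow2_abs (s - t)); lra.
Qed.

Lemma taylor2 (f f1 f2 : R -> R) t0 r M t s :
  (forall y, Rabs (y - t0) < r -> is_derive f y (f1 y)) ->
  (forall y, Rabs (y - t0) < r -> is_derive f1 y (f2 y)) ->
  (forall y, Rabs (y - t0) < r -> Rabs (f2 y) <= M) ->
  Rabs (t - t0) < r -> Rabs (s - t0) < r ->
  Rabs (f s - f t - (s - t) * f1 t) <= M * (s - t) ^ 2.
Proof.
  intros D1 D2 B Ht Hs; apply quadratic_bound; intros z Hz;
    assert (Hz0 : Rabs (z - t0) < r) by (apply (abs_between_lt t0 t s); auto); auto.
  apply (MVT_bound f1 f2); intros y Hy; [apply D2 | apply B];
    apply (abs_between_lt t0 t z); auto.
Qed.

Lemma local_bounds (D : R * R -> Prop) (l : list (R -> R -> R)) t0 x0 :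
  open D -> D (t0, x0) -> (forall f, In f l -> smooth_on D f) ->
  exists M r, 0 < r /\ 0 <= M /\
    forall t x, Rabs (t - t0) < r -> Rabs (x - x0) < r ->
      D (t, x) /\ forall f, In f l -> Rabs (f t x) <= M.
Proof.
  intros HD Hp; induction l as [|g l IH]; intros Hl.
  - destruct (open_locally_2d D t0 x0 HD Hp) as [d Hd].
    exists 0, d; split; [apply cond_pos|]; split; [lra|].
    intros t x Ht Hx; split; auto; intros f [].
  - destruct IH as [M [r [Hr [HM H]]]]; [intros; apply Hl; right; auto|].
    assert (Hg := smooth_on_continuity D g t0 x0 (Hl g (or_introl eq_refl)) Hp).
    destruct (Hg (mkposreal 1 Rlt_0_1)) as [d Hd]; simpl in Hd.
    exists (M + (Rabs (g t0 x0) + 1)), (Rmin r d).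
    pose proof (Rabs_pos (g t0 x0)).
    split; [apply Rmin_pos; auto; apply cond_pos|]; split; [lra|].
    intros t x Ht Hx.
    destruct (H t x) as [H1 H2]; try (eapply Rlt_le_trans; [eassumption | apply Rmin_l]).
    split; auto; intros f [<-|Hf].
    + assert (A := Hd t x (Rlt_le_trans _ _ _ Ht (Rmin_r _ _))
                         (Rlt_le_trans _ _ _ Hx (Rmin_r _ _))).
      replace (g t x) with (g t x - g t0 x0 + g t0 x0) by ring.
      eapply Rle_trans; [apply Rabs_triang | lra].
    + specialize (H2 f Hf); lra.
Qed.

Lemma open_intro (U : R * R -> Prop) :
  (forall t x, U (t, x) -> locally_2d (fun s y => U (s, y)) t x) -> open U.
Proof.
  intros H [t x] Hp; assert (L := proj1 (locally_2d_locally _ _ _) (H t x Hp)).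
  eapply filter_imp; [| exact L]; intros [s y]; auto.
Qed.

Definition box (t0 x0 d : R) (q : R * R) : Prop :=
  Rabs (fst q - t0) < d /\ Rabs (snd q - x0) < d.

Lemma open_box t0 x0 d : open (box t0 x0 d).
Proof.
  apply open_intro; intros t x [Ht Hx]; simpl in Ht, Hx.
  assert (Hp : 0 < Rmin (d - Rabs (t - t0)) (d - Rabs (x - x0)))
    by (apply Rmin_pos; lra).
  exists (mkposreal _ Hp); simpl; intros s y Hs Hy; split; simpl.
  - assert (A := Rlt_le_trans _ _ _ Hs (Rmin_l _ _)).
    replace (s - t0) with ((s - t) + (t - t0)) by ring.
    eapply Rle_lt_trans; [apply Rabs_triang | lra].
  - assert (A := Rlt_le_trans _ _ _ Hy (Rmin_r _ _)).
    replace (y - x0) with ((y - x) + (x - x0)) by ring.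
    eapply Rle_lt_trans; [apply Rabs_triang | lra].
Qed.

(** * The Frobenius theorem for linear systems in two unknowns *)

(** The difference splits into the old coefficients acting on [u' - u] and the change of
    coefficients acting on the bounded [u']. *)
Lemma aff_diff_bound (a a' : bool -> R) (c c' : R) (u u' : bool -> R) M N B :
  0 <= M -> 0 <= N ->
  (forall j, Rabs (a j) <= M) -> (forall j, Rabs (a' j - a j) <= N) ->
  Rabs (c' - c) <= N -> (forall j, Rabs (u' j) <= B) ->
  Rabs (aff a' c' u' - aff a c u) <=
  M * (Rabs (u' true - u true) + Rabs (u' false - u false)) + N * (2 * B + 1).
Proof.
  intros HM HN Ha Haa Hc Hu.
  replace (aff a' c' u' - aff a c u) with
    (aff a 0 (fun j => u' j - u j) + aff (fun j => a' j - a j) (c' - c) u')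
    by (unfold aff; ring).
  eapply Rle_trans; [apply Rabs_triang|].
  assert (H1 := aff_bound a 0 (fun j => u' j - u j) M 0 HM Ha).
  rewrite Rabs_R0 in H1; specialize (H1 (Rle_refl 0)).
  assert (H2 := aff_bound (fun j => a' j - a j) (c' - c) u' N N HN Haa Hc).
  assert (N * (Rabs (u' true) + Rabs (u' false)) <= N * (B + B))
    by (apply Rmult_le_compat_l; auto; apply Rplus_le_compat; auto).
  lra.
Qed.

Definition aff2 (P : bool -> R -> R -> R) (p : R -> R -> R) (u : bool -> R -> R -> R)
    (t x : R) : R :=
  aff (fun j => P j t x) (p t x) (fun j => u j t x).

Lemma diff_on_aff2 D n P p u :
  open D -> (forall j, diff_on D n (P j)) -> diff_on D n p ->
  (forall j, diff_on D n (u j)) -> diff_on D n (aff2 P p u).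
Proof.
  intros HD HP Hp Hu; apply diff_on_plus; auto.
  apply (diff_on_plus D n (fun t x => P true t x * u true t x)); auto;
    apply diff_on_mult; auto.
Qed.

(** Equality of mixed derivatives for u_x = P u + p, u_t = Q u + q, with the first derivatives
    already substituted: the zero-curvature condition. It is asked for every vector [u], since no
    solution is available yet. *)
Definition compatible (P Q : bool -> bool -> R -> R -> R) (p q : bool -> R -> R -> R)
    (t x : R) : Prop :=
  forall (i : bool) (u : bool -> R),
    aff (fun j => dt (P i j) t x) (dt (p i) t x) u
    + aff (fun j => P i j t x) 0 (fun j => aff (fun k => Q j k t x) (q j t x) u)
    = aff (fun j => dx (Q i j) t x) (dx (q i) t x) u
    + aff (fun j => Q i j t x) 0 (fun j => aff (fun k => P j k t x) (p j t x) u).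

Lemma is_derive_aff (a u : bool -> R -> R) (c : R -> R) (a' u' : bool -> R) (c' x : R) :
  (forall j, is_derive (a j) x (a' j)) -> is_derive c x c' ->
  (forall j, is_derive (u j) x (u' j)) ->
  is_derive (fun y => aff (fun j => a j y) (c y) (fun j => u j y)) x
    (aff a' c' (fun j => u j x) + aff (fun j => a j x) 0 u').
Proof.
  intros Ha Hc Hu.
  replace (_ + _) with ((a' true * u true x + a true x * u' true)
    + (a' false * u false x + a false x * u' false) + c')
    by (unfold aff; ring).
  apply (is_derive_plus (fun y => a true y * u true y + a false y * u false y) c); auto.
  apply (is_derive_plus (fun y => a true y * u true y) (fun y => a false y * u false y));
    apply is_derive_Rmult; auto.
Qed.

(* Solve the [t]-equation along [x = x0], then the [x]-equation for each fixed [t].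
   The increments [u s - u t] and [u s - u t - (s - t) (Q u + q)] satisfy linear
   equations in [x] with source terms of order [s - t] and [(s - t)^2], the latter by
   compatibility; [linear_estimate] then shows that [u] is Lipschitz in [t] and has
   the required [t]-derivative. *)
Lemma frobenius (D : R * R -> Prop) (P Q : bool -> bool -> R -> R -> R)
    (p q : bool -> R -> R -> R) (t0 x0 : R) (u0 : bool -> R) :
  open D -> D (t0, x0) ->
  (forall i j, smooth_on D (P i j)) -> (forall i j, smooth_on D (Q i j)) ->
  (forall i, smooth_on D (p i)) -> (forall i, smooth_on D (q i)) ->
  (forall t x, D (t, x) -> compatible P Q p q t x) ->
  exists (d : R) (u : bool -> R -> R -> R),
    0 < d /\ (forall z, box t0 x0 d z -> D z) /\
    (forall i, u i t0 x0 = u0 i) /\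
    (forall i, smooth_on (box t0 x0 d) (u i)) /\
    forall i t x, box t0 x0 d (t, x) ->
      is_derive (fun s => u i s x) t (aff2 (Q i) (q i) u t x) /\
      is_derive (fun y => u i t y) x (aff2 (P i) (p i) u t x).
Proof.
  intros HD Hp0 SP SQ Sp Sq Hcomp.
  (* All functions that need a bound. Second [t]-derivatives occur for [P] and [p] only, because it
     is the [x]-equation that is expanded to second order in [t]. *)
  set (l := flat_map (fun i => p i :: dt (p i) :: dt (dt (p i)) :: q i :: dt (q i) ::
    flat_map (fun j => P i j :: dt (P i j) :: dt (dt (P i j)) :: Q i j
      :: dt (Q i j) :: nil) (true :: false :: nil)) (true :: false :: nil)).
  destruct (local_bounds D l t0 x0 HD Hp0) as [M [r [Hr [HM Hbox]]]].
  { intros f Hf; unfold l in Hf; apply in_flat_map in Hf; destruct Hf as [i [_ Hf]].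
    simpl in Hf; repeat (destruct Hf as [<-|Hf]; [auto using smooth_on_dt|]).
    destruct Hf. }
  assert (HDr : forall t x, Rabs (t - t0) < r -> Rabs (x - x0) < r -> D (t, x))
    by (intros t x Ht Hx; apply (Hbox t x Ht Hx)).
  assert (Hb : forall f, In f l -> forall t x, Rabs (t - t0) < r -> Rabs (x - x0) < r ->
    Rabs (f t x) <= M) by (intros f Hf t x Ht Hx; apply (Hbox t x Ht Hx); auto).
  assert (bP : forall i j, In (P i j) l) by (intros [] []; simpl; tauto).
  assert (bPt : forall i j, In (dt (P i j)) l) by (intros [] []; simpl; tauto).
  assert (bPtt : forall i j, In (dt (dt (P i j))) l) by (intros [] []; simpl; tauto).
  assert (bQ : forall i j, In (Q i j) l) by (intros [] []; simpl; tauto).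
  assert (bQt : forall i j, In (dt (Q i j)) l) by (intros [] []; simpl; tauto).
  assert (bp : forall i, In (p i) l) by (intros []; simpl; tauto).
  assert (bpt : forall i, In (dt (p i)) l) by (intros []; simpl; tauto).
  assert (bptt : forall i, In (dt (dt (p i))) l) by (intros []; simpl; tauto).
  assert (bq : forall i, In (q i) l) by (intros []; simpl; tauto).
  assert (bqt : forall i, In (dt (q i)) l) by (intros []; simpl; tauto).
  clearbody l; clear Hbox.
  (* This gives [d < r] and [4 * M * d <= 1]; with [M + 1] in place of [M] it also gives
     [d <= 1 / 4], so that a factor [4 * Rabs (x - x0)] is at most 1. *)
  set (d := Rmin (r / 2) (/ (4 * (M + 1)))).
  assert (Hi : 0 < / (4 * (M + 1))) by (apply Rinv_0_lt_compat; lra).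
  assert (Hd : 0 < d) by (apply Rmin_pos; lra).
  assert (Hdr : d < r) by (assert (d <= r / 2) by apply Rmin_l; lra).
  assert (HMd : 4 * M * d <= 1).
  { assert (d <= / (4 * (M + 1))) by apply Rmin_r.
    assert (4 * (M + 1) * / (4 * (M + 1)) = 1) by (field; lra).
    assert (4 * (M + 1) * d <= 4 * (M + 1) * / (4 * (M + 1)))
      by (apply Rmult_le_compat_l; lra).
    lra. }
  assert (Hd4 : d <= 1 / 4).
  { apply Rle_trans with (1 := Rmin_r _ _); unfold Rdiv; rewrite Rmult_1_l.
    apply Rinv_le_contravar; lra. }
  clearbody d; clear Hi.
  assert (HMe : forall e, Rabs e <= d -> 4 * M * Rabs e <= 1).
  { intros e He; apply Rle_trans with (2 := HMd); apply Rmult_le_compat_l; lra. }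
  assert (Z0 : Rabs (x0 - x0) < r) by (rewrite Rminus_diag, Rabs_R0; auto).
  assert (contx : forall f t x, smooth_on D f -> Rabs (t - t0) < r ->
    Rabs (x - x0) < r -> continuous (fun y => f t y) x).
  { intros f t x Sf Ht Hx; apply (ex_derive_continuous (fun y => f t y)).
    eexists; apply (smooth_on_derive_x D); auto. }
  assert (contt : forall f t x, smooth_on D f -> Rabs (t - t0) < r ->
    Rabs (x - x0) < r -> continuous (fun s => f s x) t).
  { intros f t x Sf Ht Hx; apply (ex_derive_continuous (fun s => f s x)).
    eexists; apply (smooth_on_derive_t D); auto. }
  destruct (linear_ode (fun i j s => Q i j s x0) (fun i s => q i s x0) t0 d r M u0)
    as [w [w0 Dw]]; auto.
  (* A solution in [x] is chosen separately for each [t], so its regularity in [t] has to be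
     recovered by the estimates that follow. *)
  assert (Hu : forall t, {y : bool -> R -> R | Rabs (t - t0) < d ->
    (forall i, y i x0 = w i t) /\
    forall i s, Rabs (s - x0) < d ->
      is_derive (y i) s (aff (fun j => P i j t s) (p i t s) (fun j => y j s))}).
  { intros t; apply constructive_indefinite_description.
    (* Zero is a placeholder for [t] outside the interval. *)
    destruct (Rlt_dec (Rabs (t - t0)) d) as [Ht|Ht]; [|exists (fun _ _ => 0); tauto].
    destruct (linear_ode (fun i j s => P i j t s) (fun i s => p i t s) x0 d r M
      (fun i => w i t)) as [y Hy]; auto; try lra;
      intros; [apply contx | apply contx | apply Hb | apply Hb |]; auto; try lra.
    exists y; auto. }
  set (u := fun i t x => proj1_sig (Hu t) i x).
  assert (ux0 : forall i t, Rabs (t - t0) < d -> u i t x0 = w i t)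
    by (intros i t Ht; apply (proj2_sig (Hu t) Ht)).
  assert (Dx : forall i t x, Rabs (t - t0) < d -> Rabs (x - x0) < d ->
    is_derive (fun y => u i t y) x (aff2 (P i) (p i) u t x))
    by (intros i t x Ht Hx; apply (proj2_sig (Hu t) Ht); auto).
  clearbody u; clear Hu.
  (* [B0] bounds [w] and [B] bounds [u]: both come from [linear_estimate] with source [M], whose
     contribution [4 * M * d] is at most 1. *)
  set (B0 := 4 * (Rabs (u0 true) + Rabs (u0 false)) + 1).
  set (B := 4 * B0 + 1).
  assert (HB0 : 0 <= B0)
    by (unfold B0; pose proof (Rabs_pos (u0 true)); pose proof (Rabs_pos (u0 false)); lra).
  assert (Bw : forall i t, Rabs (t - t0) < d -> Rabs (w i t) <= B0).
  { intros i t Ht.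
    eapply Rle_trans; [apply (linear_estimate w
      (fun i s => aff (fun j => Q i j s x0) (q i s x0) (fun j => w j s)) t0 t M M
      (Rabs (u0 true) + Rabs (u0 false)))|]; auto.
    - apply HMe; lra.
    - intros; apply Dw; lra.
    - intros; apply aff_bound; auto; intros; apply Hb; auto; lra.
    - intros j; rewrite w0; pose proof (Rabs_pos (u0 true));
        pose proof (Rabs_pos (u0 false)); destruct j; lra.
    - pose proof (HMe (t - t0)); unfold B0; lra. }
  assert (Bu : forall i t x, Rabs (t - t0) < d -> Rabs (x - x0) < d ->
    Rabs (u i t x) <= B).
  { intros i t x Ht Hx.
    eapply Rle_trans; [apply (linear_estimate (fun i y => u i t y)
      (fun i y => aff2 (P i) (p i) u t y) x0 x M M B0)|]; auto.
    - apply HMe; lra.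
    - intros; apply Dx; lra.
    - intros; apply aff_bound; auto; intros; apply Hb; auto; lra.
    - intros j; rewrite ux0; auto.
    - pose proof (HMe (x - x0)); unfold B; lra. }
  (* Bounds any right-hand side with coefficients at most [M] and unknowns at most [B], hence is a
     Lipschitz constant for [w] in [t] and for [u] in [x]. *)
  set (C := M * (2 * B + 1)).
  assert (HC : 0 <= C) by (apply Rmult_le_pos; unfold B; lra).
  assert (Lw : forall i t s, Rabs (t - t0) < d -> Rabs (s - t0) < d ->
    Rabs (w i s - w i t) <= C * Rabs (s - t)).
  { intros i t s Ht Hs.
    apply (MVT_bound (w i)
      (fun s => aff (fun j => Q i j s x0) (q i s x0) (fun j => w j s)));
      intros z Hz;
      assert (Hz0 : Rabs (z - t0) < d) by (apply (abs_between_lt t0 t s); auto); auto.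
    eapply Rle_trans; [apply (aff_bound _ _ _ M M); auto;
      intros; apply Hb; auto; lra |].
    assert (M * (Rabs (w true z) + Rabs (w false z)) <= M * (B0 + B0))
      by (apply Rmult_le_compat_l; auto; apply Rplus_le_compat; auto).
    assert (M * (B0 + B0) <= M * (2 * B))
      by (apply Rmult_le_compat_l; auto; unfold B; lra).
    unfold C; lra. }
  assert (LPt : forall f t s x, smooth_on D f -> In (dt f) l -> Rabs (t - t0) < d ->
    Rabs (s - t0) < d -> Rabs (x - x0) < d -> Rabs (f s x - f t x) <= M * Rabs (s - t)).
  { intros f t s x Sf If Ht Hs Hx.
    apply (MVT_bound (fun s => f s x) (fun s => dt f s x)); intros z Hz;
      assert (Hz0 : Rabs (z - t0) < d) by (apply (abs_between_lt t0 t s); auto).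
    - apply (smooth_on_derive_t D); auto; apply HDr; lra.
    - apply Hb; auto; lra. }
  (* [linear_estimate] yields [4 * C] from the line [x = x0] and at most [C] from the source
     term. *)
  set (L := 8 * C).
  assert (Lt : forall i t s x, Rabs (t - t0) < d -> Rabs (s - t0) < d ->
    Rabs (x - x0) < d -> Rabs (u i s x - u i t x) <= L * Rabs (s - t)).
  { intros i t s x Ht Hs Hx.
    assert (Hst := Rabs_pos (s - t)).
    eapply Rle_trans; [apply (linear_estimate (fun i y => u i s y - u i t y)
      (fun i y => aff2 (P i) (p i) u s y - aff2 (P i) (p i) u t y) x0 x M
      (M * Rabs (s - t) * (2 * B + 1)) (C * Rabs (s - t)))|]; auto.
    - repeat apply Rmult_le_pos; unfold B; lra.
    - apply HMe; lra.
    - intros j y Hy; apply (is_derive_minus (fun y => u j s y) (fun y => u j t y));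
        apply Dx; lra.
    - intros j y Hy; apply aff_diff_bound; auto; try (intros; apply Hb; auto; lra).
      + apply Rmult_le_pos; auto.
      + intros; apply LPt; auto; lra.
      + intros; apply LPt; auto; lra.
      + intros; apply Bu; auto; lra.
    - intros j; rewrite !ux0; auto.
    - replace (M * Rabs (s - t) * (2 * B + 1)) with (C * Rabs (s - t))
        by (unfold C; ring).
      assert (0 <= C * Rabs (s - t)) by (apply Rmult_le_pos; auto).
      assert (4 * Rabs (x - x0) * (C * Rabs (s - t)) <= 1 * (C * Rabs (s - t)))
        by (apply Rmult_le_compat_r; auto; lra).
      unfold L; lra. }
  assert (HL : 0 <= L) by (unfold L; lra).
  (* The remainder on the line [x = x0], which is the initial value for the remainder of [u] in
     [Qu]. *)
  assert (Qw : forall i t s, Rabs (t - t0) < d -> Rabs (s - t0) < d ->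
    Rabs (w i s - w i t
      - (s - t) * aff (fun j => Q i j t x0) (q i t x0) (fun j => w j t))
    <= (2 * M * C + C) * (s - t) ^ 2).
  { intros i t s Ht Hs.
    apply (quadratic_bound (w i)
      (fun t => aff (fun j => Q i j t x0) (q i t x0) (fun j => w j t)));
      intros z Hz;
      assert (Hz0 : Rabs (z - t0) < d) by (apply (abs_between_lt t0 t s); auto); auto.
    eapply Rle_trans; [apply (aff_diff_bound _ _ _ _ _ _ M (M * Rabs (z - t)) B); auto |].
    - apply Rmult_le_pos; auto using Rabs_pos.
    - intros; apply Hb; auto; lra.
    - intros; apply LPt; auto; rewrite Rminus_diag, Rabs_R0; auto.
    - intros; apply LPt; auto; rewrite Rminus_diag, Rabs_R0; auto.
    - intros j; specialize (Bw j z Hz0); unfold B; lra.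
    - assert (M * (Rabs (w true z - w true t) + Rabs (w false z - w false t))
        <= M * (C * Rabs (z - t) + C * Rabs (z - t)))
        by (apply Rmult_le_compat_l; auto; apply Rplus_le_compat; auto).
      replace ((2 * M * C + C) * Rabs (z - t)) with
        (M * (C * Rabs (z - t) + C * Rabs (z - t)) + M * Rabs (z - t) * (2 * B + 1))
        by (unfold C; ring).
      lra. }
  assert (LPP : forall f t s x, smooth_on D f -> In (dt (dt f)) l ->
    Rabs (t - t0) < d -> Rabs (s - t0) < d -> Rabs (x - x0) < d ->
    Rabs (f s x - f t x - (s - t) * dt f t x) <= M * (s - t) ^ 2).
  { intros f t s x Sf If Ht Hs Hx.
    apply (taylor2 (fun s => f s x) (fun s => dt f s x) (fun s => dt (dt f) s x) t0 d);
      auto; intros z Hz.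
    - apply (smooth_on_derive_t D); auto; apply HDr; lra.
    - apply (smooth_on_derive_t D (dt f)); auto using smooth_on_dt; apply HDr; lra.
    - apply Hb; auto; lra. }
  (* Four times the constant of [Qw], plus the constant of the second-order source term, whose
     factor [4 * Rabs (x - x0)] is at most 1. *)
  set (K := 4 * (2 * M * C + C) + (C + 2 * M * L)).
  assert (Qu : forall i t s x, Rabs (t - t0) < d -> Rabs (s - t0) < d ->
    Rabs (x - x0) < d ->
    Rabs (u i s x - u i t x - (s - t) * aff2 (Q i) (q i) u t x) <= K * (s - t) ^ 2).
  { intros i t s x Ht Hs Hx.
    assert (He2 : 0 <= (s - t) ^ 2) by apply pow2_ge_0.
    eapply Rle_trans; [apply (linear_estimate
      (fun i y => u i s y - u i t y - (s - t) * aff2 (Q i) (q i) u t y)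
      (fun i y => aff2 (P i) (p i) u s y - aff2 (P i) (p i) u t y - (s - t) *
        (aff (fun j => dt (P i j) t y) (dt (p i) t y) (fun j => u j t y)
         + aff (fun j => P i j t y) 0 (fun j => aff2 (Q j) (q j) u t y)))
      x0 x M ((C + 2 * M * L) * (s - t) ^ 2) ((2 * M * C + C) * (s - t) ^ 2))|]; auto.
    - apply Rmult_le_pos; auto.
      assert (0 <= M * L) by (apply Rmult_le_pos; auto); lra.
    - apply HMe; lra.
    - intros j y Hy.
      assert (Hty : D (t, y)) by (apply HDr; lra).
      apply (is_derive_minus (fun y => u j s y - u j t y)
        (fun y => (s - t) * aff2 (Q j) (q j) u t y)).
      + apply (is_derive_minus (fun y => u j s y) (fun y => u j t y)); apply Dx; lra.
      + apply (is_derive_scal (aff2 (Q j) (q j) u t)).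
        (* Compatibility enters here: it replaces the [t]-derivative of the right-hand side of the
           [x]-equation by the [x]-derivative of that of the [t]-equation. *)
        unfold aff2; rewrite (Hcomp t y Hty j (fun k => u k t y)).
        apply (is_derive_aff (fun k => Q j k t) (fun k => u k t) (q j t)).
        * intros k; apply (smooth_on_derive_x D); auto.
        * apply (smooth_on_derive_x D); auto.
        * intros k; apply Dx; lra.
    - intros j y Hy; set (e := s - t) in *.
      (* Three pieces: the linear [x]-equation applied to the remainder itself, the Taylor
         remainders of the coefficients, and a product of two increments. The last two are of order
         [e ^ 2]. *)
      match goal with |- Rabs ?a <= _ => replace a with
        (aff (fun k => P j k t y) 0
           (fun k => u k s y - u k t y - e * aff2 (Q k) (q k) u t y)
         + aff (fun k => P j k s y - P j k t y - e * dt (P j k) t y)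
             (p j s y - p j t y - e * dt (p j) t y) (fun k => u k t y)
         + aff (fun k => P j k s y - P j k t y) 0 (fun k => u k s y - u k t y))
        by (unfold aff2, aff; ring) end.
      assert (Hy' : Rabs (y - x0) < d) by lra.
      assert (He := Rabs_pos e).
      assert (A1 := aff_bound (fun k => P j k t y) 0
        (fun k => u k s y - u k t y - e * aff2 (Q k) (q k) u t y) M 0 HM).
      assert (A2 := aff_bound (fun k => P j k s y - P j k t y - e * dt (P j k) t y)
        (p j s y - p j t y - e * dt (p j) t y) (fun k => u k t y)
        (M * e ^ 2) (M * e ^ 2)).
      assert (A3 := aff_bound (fun k => P j k s y - P j k t y) 0
        (fun k => u k s y - u k t y) (M * Rabs e) 0).
      rewrite Rabs_R0 in A1, A3.
      lapply A1; [clear A1; intros A1 | intros; apply Hb; auto; lra].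
      lapply A2; [clear A2; intros A2 | apply Rmult_le_pos; auto].
      lapply A2; [clear A2; intros A2 | intros; apply LPP; auto].
      lapply A2; [clear A2; intros A2 | apply LPP; auto].
      lapply A3; [clear A3; intros A3 | apply Rmult_le_pos; auto].
      lapply A3; [clear A3; intros A3 | intros; apply LPt; auto].
      specialize (A1 (Rle_refl 0)); specialize (A3 (Rle_refl 0)); cbv beta in A1, A2, A3.
      eapply Rle_trans; [apply Rabs_triang|].
      eapply Rle_trans; [apply Rplus_le_compat_r, Rabs_triang|].
      assert (M * e ^ 2 * (Rabs (u true t y) + Rabs (u false t y)) <= M * e ^ 2 * (B + B)).
      { apply Rmult_le_compat_l; [apply Rmult_le_pos; auto|].
        apply Rplus_le_compat; apply Bu; auto. }
      assert (M * Rabs e * (Rabs (u true s y - u true t y) + Rabs (u false s y - u false t y))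
        <= M * Rabs e * (L * Rabs e + L * Rabs e)).
      { apply Rmult_le_compat_l; [apply Rmult_le_pos; auto|].
        apply Rplus_le_compat; apply Lt; auto. }
      replace ((C + 2 * M * L) * e ^ 2) with
        (M * e ^ 2 * (B + B) + M * e ^ 2 + M * Rabs e * (L * Rabs e + L * Rabs e))
        by (rewrite <- (pow2_abs e); unfold C; ring).
      lra.
    - intros j; unfold aff2; rewrite !ux0 by auto.
      assert (E : forall k, u k t x0 = w k t) by auto.
      unfold aff; rewrite !E; apply (Qw j t s Ht Hs).
    - set (Y := (C + 2 * M * L) * (s - t) ^ 2).
      assert (HY : 0 <= Y).
      { apply Rmult_le_pos; auto.
        assert (0 <= M * L) by (apply Rmult_le_pos; auto); lra. }
      assert (4 * Rabs (x - x0) * Y <= 1 * Y) by (apply Rmult_le_compat_r; auto; lra).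
      unfold K; rewrite (Rmult_plus_distr_r _ (C + 2 * M * L)); fold Y; lra. }
  assert (Dt : forall i t x, Rabs (t - t0) < d -> Rabs (x - x0) < d ->
    is_derive (fun s => u i s x) t (aff2 (Q i) (q i) u t x)).
  { intros i t x Ht Hx.
    apply (is_derive_quadratic (fun s => u i s x) t _ K (d - Rabs (t - t0))); [lra|].
    intros e He; assert (Q1 := Qu i t (t + e) x Ht).
    replace (t + e - t) with e in Q1 by ring; apply Q1; auto.
    replace (t + e - t0) with ((t - t0) + e) by ring.
    eapply Rle_lt_trans; [apply Rabs_triang | lra]. }
  assert (Cu : forall i t x, box t0 x0 d (t, x) -> continuity_2d_pt (u i) t x).
  { intros i t x [Ht Hx] eps; simpl in Ht, Hx.
    assert (Hm : 0 < eps / (L + C + 1))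
      by (apply Rdiv_lt_0_compat; [apply cond_pos | lra]).
    destruct (open_locally_2d _ t x (open_box t0 x0 d) (conj Ht Hx)) as [r' Hr'].
    assert (Hp : 0 < Rmin r' (eps / (L + C + 1))) by (apply Rmin_pos; auto; apply cond_pos).
    exists (mkposreal _ Hp); simpl; intros s y Hs Hy.
    destruct (Hr' s y) as [Hs0 Hy0];
      try (eapply Rlt_le_trans; [eassumption | apply Rmin_l]).
    simpl in Hs0, Hy0.
    assert (A1 := Rlt_le_trans _ _ _ Hs (Rmin_r _ _)).
    assert (A2 := Rlt_le_trans _ _ _ Hy (Rmin_r _ _)).
    assert (A3 := Lt i t s y Ht Hs0 Hy0).
    assert (A4 : Rabs (u i t y - u i t x) <= C * Rabs (y - x)).
    { apply (MVT_bound (fun y => u i t y) (fun y => aff2 (P i) (p i) u t y)); intros z Hz;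
        assert (Hz0 : Rabs (z - x0) < d) by (apply (abs_between_lt x0 x y); auto); auto.
      eapply Rle_trans; [apply (aff_bound _ _ _ M M); auto;
        intros; apply Hb; auto; lra |].
      assert (M * (Rabs (u true t z) + Rabs (u false t z)) <= M * (B + B))
        by (apply Rmult_le_compat_l; auto; apply Rplus_le_compat; auto).
      unfold C; lra. }
    replace (u i s y - u i t x) with ((u i s y - u i t y) + (u i t y - u i t x)) by ring.
    eapply Rle_lt_trans; [apply Rabs_triang|].
    assert (A5 : eps / (L + C + 1) * (L + C + 1) = eps) by (field; lra).
    assert (L * Rabs (s - t) <= L * (eps / (L + C + 1))) by (apply Rmult_le_compat_l; lra).
    assert (C * Rabs (y - x) <= C * (eps / (L + C + 1))) by (apply Rmult_le_compat_l; lra).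
    lra. }
  exists d, u; split; [auto|].
  assert (HBD : forall z, box t0 x0 d z -> D z).
  { intros [t x] [Ht Hx]; simpl in Ht, Hx; apply HDr; lra. }
  split; [auto|].
  split; [intros i; rewrite ux0, w0; auto; rewrite Rminus_diag, Rabs_R0; auto|].
  split; [|intros i t x [Ht Hx]; auto].
  assert (HO := open_box t0 x0 d).
  assert (Hsm : forall f n, smooth_on D f -> diff_on (box t0 x0 d) n f)
    by (intros f n Sf t x Hq; apply Sf; auto).
  (* Bootstrapping: both partial derivatives are affine in [u] with smooth coefficients, so each
     order of regularity gives the next. *)
  assert (Hn : forall n i, diff_on (box t0 x0 d) n (u i)).
  { induction n; intros i.
    - intros t x Hq; split; [apply Cu; auto | exact I].
    - apply (diff_on_S _ n _ (aff2 (Q i) (q i) u) (aff2 (P i) (p i) u)); auto.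
      + intros t x [Ht Hx]; auto.
      + intros t x [Ht Hx]; auto.
      + apply diff_on_aff2; auto.
      + apply diff_on_aff2; auto. }
  intros i; apply smooth_on_diff; auto.
Qed.

(** * The nonlinear system as an integrability condition *)

Definition res1 (A B g1 g2 : R -> R -> R) (t x : R) : R :=
  dt g1 t x - A t x * dx (dx g1) t x - B t x * dx g1 t x
    + coupling A g1 t x * (g1 t x + B t x)
    + dx B t x * g1 t x + 2 * A t x * dx g2 t x + dt B t x.

Definition res2 (A B C g1 g2 : R -> R -> R) (t x : R) : R :=
  dt g2 t x - A t x * dx (dx g2) t x - B t x * dx g2 t x
    + coupling A g1 t x * (g2 t x - C t x)
    - dx C t x * g1 t x - dt C t x.

(** Also applied to the zero function in place of [g3], which is the case of [v1] and [v2]. *)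
Definition res3 (A B C g1 g3 : R -> R -> R) (t x : R) : R :=
  dt g3 t x - A t x * dx (dx g3) t x - B t x * dx g3 t x
    + coupling A g1 t x * g3 t x - C t x * g3 t x.

(* The pair of equations equivalent to [linear_eq] together with the
   differential equation in [x] whose solutions are [v1], [v2] (for [G = 0])
   and [v3] (for [G = g3]). *)
Definition lax_pair (A B C g1 g2 G v : R -> R -> R) (t x : R) : Prop :=
  dt v t x = - g1 t x * dx v t x + g2 t x * v t x + G t x /\
  A t x * dx (dx v) t x =
    - (g1 t x + B t x) * dx v t x + (g2 t x - C t x) * v t x + G t x.

Ltac ex_derive_smooth lem :=
  repeat split; eexists; apply lem; auto.

(** Differentiating v_t twice in [x] expresses v_txx through [x]-derivatives of v. Substituting this
    into the [t]-derivative of the second equation of the pair leaves v_xx and v_xxx to be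
    eliminated. *)
Lemma lax_pair_compatibility D A B C g1 g2 G v :
  open D -> smooth_on D A -> smooth_on D B -> smooth_on D C ->
  smooth_on D g1 -> smooth_on D g2 -> smooth_on D G -> smooth_on D v ->
  (forall t x, D (t, x) -> A t x <> 0) ->
  (forall t x, D (t, x) -> lax_pair A B C g1 g2 G v t x) ->
  forall t x, D (t, x) ->
    res1 A B g1 g2 t x * dx v t x - res2 A B C g1 g2 t x * v t x
    - res3 A B C g1 G t x = 0.
Proof.
  intros HD SA SB SC S1 S2 SG Sv HA HL t x Hp.
  assert (Sw := smooth_on_dx _ _ Sv); assert (Swx := smooth_on_dx _ _ Sw).
  assert (S1x := smooth_on_dx _ _ S1); assert (S2x := smooth_on_dx _ _ S2).
  assert (SGx := smooth_on_dx _ _ SG).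
  assert (E1 : forall t x, D (t, x) -> dx (dt v) t x =
    - (dx g1 t x * dx v t x + g1 t x * dx (dx v) t x)
    + (dx g2 t x * v t x + g2 t x * dx v t x) + dx G t x).
  { intros s y Hq.
    rewrite (dx_ext_on D (dt v)
      (fun t x => - g1 t x * dx v t x + g2 t x * v t x + G t x)); auto.
    2: intros; apply HL; auto.
    apply is_derive_unique; auto_derive.
    - ex_derive_smooth (smooth_on_derive_x D).
    - unfold dx; ring. }
  assert (E2 : dx (dx (dt v)) t x =
    - (dx (dx g1) t x * dx v t x + 2 * (dx g1 t x * dx (dx v) t x)
       + g1 t x * dx (dx (dx v)) t x)
    + (dx (dx g2) t x * v t x + 2 * (dx g2 t x * dx v t x)
       + g2 t x * dx (dx v) t x) + dx (dx G) t x).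
  { rewrite (dx_ext_on D (dx (dt v)) (fun t x =>
      - (dx g1 t x * dx v t x + g1 t x * dx (dx v) t x)
      + (dx g2 t x * v t x + g2 t x * dx v t x) + dx G t x)); auto.
    apply is_derive_unique; auto_derive.
    - ex_derive_smooth (smooth_on_derive_x D).
    - unfold dx; ring. }
  assert (H2 : dt (dx v) t x = dx (dt v) t x) by (apply (dt_dx_comm D); auto).
  assert (H3 : dt (dx (dx v)) t x = dx (dx (dt v)) t x).
  { rewrite (dt_dx_comm D); auto; apply (dx_ext_on D); auto.
    intros; apply (dt_dx_comm D); auto. }
  rewrite E1 in H2 by auto; rewrite E2 in H3.
  assert (H4 : dx A t x * dx (dx v) t x + A t x * dx (dx (dx v)) t x =
    - ((dx g1 t x + dx B t x) * dx v t x + (g1 t x + B t x) * dx (dx v) t x)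
    + ((dx g2 t x - dx C t x) * v t x + (g2 t x - C t x) * dx v t x) + dx G t x).
  { transitivity (dx (fun t x => A t x * dx (dx v) t x) t x).
    - symmetry; apply is_derive_unique; auto_derive;
        [ex_derive_smooth (smooth_on_derive_x D) | unfold dx; ring].
    - rewrite (dx_ext_on D _ (fun t x => - (g1 t x + B t x) * dx v t x
        + (g2 t x - C t x) * v t x + G t x)); auto.
      2: intros; apply HL; auto.
      apply is_derive_unique; auto_derive;
        [ex_derive_smooth (smooth_on_derive_x D) | unfold dx; ring]. }
  assert (H5 : dt A t x * dx (dx v) t x + A t x * dt (dx (dx v)) t x =
    - ((dt g1 t x + dt B t x) * dx v t x + (g1 t x + B t x) * dt (dx v) t x)
    + ((dt g2 t x - dt C t x) * v t x + (g2 t x - C t x) * dt v t x) + dt G t x).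
  { transitivity (dt (fun t x => A t x * dx (dx v) t x) t x).
    - symmetry; apply is_derive_unique; auto_derive;
        [ex_derive_smooth (smooth_on_derive_t D) | unfold dt; ring].
    - rewrite (dt_ext_on D _ (fun t x => - (g1 t x + B t x) * dx v t x
        + (g2 t x - C t x) * v t x + G t x)); auto.
      2: intros; apply HL; auto.
      apply is_derive_unique; auto_derive;
        [ex_derive_smooth (smooth_on_derive_t D) | unfold dt; ring]. }
  destruct (HL t x Hp) as [H1 H6]; specialize (HA t x Hp).
  assert (Hc : coupling A g1 t x * A t x =
    2 * A t x * dx g1 t x - dx A t x * g1 t x - dt A t x)
    by (unfold coupling; field; auto).
  unfold res1, res2, res3.
  set (c := coupling A g1 t x) in *.
  rewrite H3, H2, H1 in H5.
  set (vx := dx v t x) in *; set (vxx := dx (dx v) t x) in *.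
  set (vxxx := dx (dx (dx v)) t x) in *.
  set (a := A t x) in *; set (b := g1 t x) in *; set (b2 := g2 t x) in *.
  apply Rminus_diag_eq in Hc, H4, H5, H6.
  (* [g1] times the [x]-derivative of the second equation cancels v_xxx, a multiple of the equation
     itself cancels v_xx, and [lc] trades [A] times the quotient [coupling] for its numerator, so
     that [ring] suffices. *)
  match type of Hc with ?lc = 0 => match type of H4 with ?l4 = 0 =>
  match type of H5 with ?l5 = 0 => match type of H6 with ?l6 = 0 =>
    replace (_ - _ - _) with (l5 + b * l4 + (c - b2) * l6 - vxx * lc) by ring;
    rewrite Hc, H4, H5, H6; ring
  end end end end.
Qed.

Lemma res3_zero A B C g1 t x : res3 A B C g1 (fun _ _ => 0) t x = 0.
Proof.
  assert (Z : forall f : R -> R -> R, (forall s y, f s y = 0) -> dx f t x = 0).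
  { intros f Hf; unfold dx; rewrite (Derive_ext _ (fun _ => 0)); auto.
    apply Derive_const. }
  unfold res3; rewrite (Z (dx _)), (Z (fun _ _ => 0)); auto.
  - unfold dt; rewrite Derive_const; ring.
  - intros s y; apply (Derive_const 0).
Qed.

(** * From linear solutions to the nonlinear system *)

Lemma represented_nonlinear D A B C g1 g2 g3 :
  open D -> smooth_on D A -> smooth_on D B -> smooth_on D C ->
  smooth_on D g1 -> smooth_on D g2 -> smooth_on D g3 ->
  (forall t x, D (t, x) -> A t x <> 0) ->
  represented_on D A B C g1 g2 g3 ->
  forall t x, D (t, x) -> nonlinear_system A B C g1 g2 g3 t x.
Proof.
  intros HD SA SB SC S1 S2 S3 HA (v1 & v2 & v3 & Sv1 & Sv2 & Sv3 & _ & H) t x Hp.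
  assert (S0 : smooth_on D (fun _ _ => 0)) by (apply smooth_on_const; auto).
  assert (HL : forall t x, D (t, x) ->
    lax_pair A B C g1 g2 (fun _ _ => 0) v1 t x /\
    lax_pair A B C g1 g2 (fun _ _ => 0) v2 t x /\
    lax_pair A B C g1 g2 g3 v3 t x).
  { intros s y Hq; destruct (H s y Hq) as (HW & L1 & L2 & L3 & T1 & T2 & T3).
    specialize (HA s y Hq); unfold linear_eq in L1, L2, L3.
    assert (M1 : A s y * dx (dx v1) s y =
      - (g1 s y + B s y) * dx v1 s y + (g2 s y - C s y) * v1 s y)
      by (rewrite T1, T2; unfold wronskian in *; field; auto).
    assert (M2 : A s y * dx (dx v2) s y =
      - (g1 s y + B s y) * dx v2 s y + (g2 s y - C s y) * v2 s y)
      by (rewrite T1, T2; unfold wronskian in *; field; auto).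
    assert (M3 : A s y * dx (dx v3) s y =
      - (g1 s y + B s y) * dx v3 s y + (g2 s y - C s y) * v3 s y + g3 s y)
      by (rewrite T1, T2, T3; unfold wronskian, det3 in *; field; auto).
    unfold lax_pair; repeat split; lra. }
  assert (E1 := lax_pair_compatibility D A B C g1 g2 (fun _ _ => 0) v1 HD SA SB SC
    S1 S2 S0 Sv1 HA (fun s y Hq => proj1 (HL s y Hq)) t x Hp).
  assert (E2 := lax_pair_compatibility D A B C g1 g2 (fun _ _ => 0) v2 HD SA SB SC
    S1 S2 S0 Sv2 HA (fun s y Hq => proj1 (proj2 (HL s y Hq))) t x Hp).
  assert (E3 := lax_pair_compatibility D A B C g1 g2 g3 v3 HD SA SB SC
    S1 S2 S3 Sv3 HA (fun s y Hq => proj2 (proj2 (HL s y Hq))) t x Hp).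
  rewrite res3_zero, Rminus_0_r in E1, E2.
  assert (HW : wronskian v1 v2 t x <> 0) by apply (H t x Hp).
  (* The identities for [v1] and [v2] are a homogeneous linear system for [res1] and [res2] whose
     determinant is the Wronskian up to sign; Cramer's rule. *)
  assert (R1 : res1 A B g1 g2 t x = 0).
  { apply (Rmult_eq_reg_r (wronskian v1 v2 t x)); auto; unfold wronskian.
    rewrite Rmult_0_l; transitivity
      (v1 t x * (res1 A B g1 g2 t x * dx v2 t x - res2 A B C g1 g2 t x * v2 t x)
       - v2 t x * (res1 A B g1 g2 t x * dx v1 t x - res2 A B C g1 g2 t x * v1 t x));
      [ring | rewrite E1, E2; ring]. }
  assert (R2 : res2 A B C g1 g2 t x = 0).
  { apply (Rmult_eq_reg_r (wronskian v1 v2 t x)); auto; unfold wronskian.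
    rewrite Rmult_0_l; transitivity
      (dx v1 t x * (res1 A B g1 g2 t x * dx v2 t x - res2 A B C g1 g2 t x * v2 t x)
       - dx v2 t x * (res1 A B g1 g2 t x * dx v1 t x - res2 A B C g1 g2 t x * v1 t x));
      [ring | rewrite E1, E2; ring]. }
  rewrite R1, R2 in E3; split; [exact R1|]; split; [exact R2|].
  change (res3 A B C g1 g3 t x = 0); lra.
Qed.

(** * From the nonlinear system back to linear solutions *)

Lemma lax_pair_solution D A B C g1 g2 G t0 x0 (u0 : bool -> R) :
  open D -> D (t0, x0) -> smooth_on D A -> smooth_on D B -> smooth_on D C ->
  smooth_on D g1 -> smooth_on D g2 -> smooth_on D G ->
  (forall t x, D (t, x) -> A t x <> 0) ->
  (forall t x, D (t, x) -> res1 A B g1 g2 t x = 0) ->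
  (forall t x, D (t, x) -> res2 A B C g1 g2 t x = 0) ->
  (forall t x, D (t, x) -> res3 A B C g1 G t x = 0) ->
  exists (d : R) (v : R -> R -> R),
    0 < d /\ (forall z, box t0 x0 d z -> D z) /\
    smooth_on (box t0 x0 d) v /\ v t0 x0 = u0 true /\ dx v t0 x0 = u0 false /\
    forall t x, box t0 x0 d (t, x) -> lax_pair A B C g1 g2 G v t x.
Proof.
  intros HD Hp0 SA SB SC S1 S2 SG HA R1 R2 R3.
  (* The second equation of the pair, solved for the highest derivative: v_xx = a v + b v_x + e. *)
  set (a := fun t x => (g2 t x - C t x) / A t x).
  set (b := fun t x => (- g1 t x - B t x) / A t x).
  set (e := fun t x => G t x / A t x).
  assert (Sa : smooth_on D a)
    by (apply smooth_on_div; auto; apply smooth_on_minus; auto).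
  assert (Sb : smooth_on D b)
    by (apply smooth_on_div; auto; apply smooth_on_minus; auto;
        apply smooth_on_opp; auto).
  assert (Se : smooth_on D e) by (apply smooth_on_div; auto).
  assert (Ea : forall t x, D (t, x) -> g2 t x = C t x + A t x * a t x)
    by (intros; unfold a; field; auto).
  assert (Eb : forall t x, D (t, x) -> g1 t x = - B t x - A t x * b t x)
    by (intros; unfold b; field; auto).
  assert (Ee : forall t x, D (t, x) -> G t x = A t x * e t x)
    by (intros; unfold e; field; auto).
  (* Keeping only [Ea], [Eb], [Ee] turns derivatives of [g1], [g2], [G] into product-rule
     expressions in [A], [a], [b], [e], with no derivative of a quotient. *)
  clearbody a b e.
  assert (S1x := smooth_on_dx _ _ S1); assert (S2x := smooth_on_dx _ _ S2).
  assert (SGx := smooth_on_dx _ _ SG).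
  (* The unknowns are indexed by [true] for [v] and [false] for [v_x]. *)
  set (P := fun i j : bool => if i then (fun _ _ : R => if j then 0 else 1)
    else if j then a else b).
  set (p := fun i : bool => if i then (fun _ _ : R => 0) else e).
  (* The equation for the [t]-derivative of v_x: the [x]-derivative of the equation for v_t, with
     v_xx eliminated. *)
  set (Qft := fun t x => dx g2 t x - g1 t x * a t x).
  set (Qff := fun t x => g2 t x - dx g1 t x - g1 t x * b t x).
  set (qf := fun t x => dx G t x - g1 t x * e t x).
  set (Q := fun i j : bool => if i then (if j then g2 else fun t x => - g1 t x)
    else if j then Qft else Qff).
  set (q := fun i : bool => if i then G else qf).
  destruct (frobenius D P Q p q t0 x0 u0) as (d & u & Hd & HB & Hu0 & Su & Du); auto.
  - intros [] []; simpl; auto; apply smooth_on_const; auto.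
  - intros [] []; simpl; auto.
    + apply smooth_on_opp; auto.
    + apply smooth_on_minus; auto; apply smooth_on_mult; auto.
    + repeat apply smooth_on_minus; auto; apply smooth_on_mult; auto.
  - intros []; simpl; auto; apply smooth_on_const; auto.
  - intros []; simpl; auto; apply smooth_on_minus; auto; apply smooth_on_mult; auto.
  - intros t x Hp.
    assert (Zc : forall c, dt (fun _ _ => c) t x = 0) by (intros c; apply (Derive_const c)).
    assert (EQ : dx (fun t x => - g1 t x) t x = - dx g1 t x) by apply (Derive_opp (g1 t)).
    assert (EQft : dx Qft t x =
      dx (dx g2) t x - (dx g1 t x * a t x + g1 t x * dx a t x)).
    { apply is_derive_unique; unfold Qft; auto_derive;
        [ex_derive_smooth (smooth_on_derive_x D) | unfold dx; ring]. }
    assert (EQff : dx Qff t x =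
      dx g2 t x - dx (dx g1) t x - (dx g1 t x * b t x + g1 t x * dx b t x)).
    { apply is_derive_unique; unfold Qff; auto_derive;
        [ex_derive_smooth (smooth_on_derive_x D) | unfold dx; ring]. }
    assert (Eqf : dx qf t x =
      dx (dx G) t x - (dx g1 t x * e t x + g1 t x * dx e t x)).
    { apply is_derive_unique; unfold qf; auto_derive;
        [ex_derive_smooth (smooth_on_derive_x D) | unfold dx; ring]. }
    assert (G2t : dt g2 t x = dt C t x + (dt A t x * a t x + A t x * dt a t x)).
    { rewrite (dt_ext_on D g2 (fun t x => C t x + A t x * a t x)); auto.
      apply is_derive_unique; auto_derive;
        [ex_derive_smooth (smooth_on_derive_t D) | unfold dt; ring]. }
    assert (G2x : dx g2 t x = dx C t x + (dx A t x * a t x + A t x * dx a t x)).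
    { rewrite (dx_ext_on D g2 (fun t x => C t x + A t x * a t x)); auto.
      apply is_derive_unique; auto_derive;
        [ex_derive_smooth (smooth_on_derive_x D) | unfold dx; ring]. }
    assert (G1t : dt g1 t x = - dt B t x - (dt A t x * b t x + A t x * dt b t x)).
    { rewrite (dt_ext_on D g1 (fun t x => - B t x - A t x * b t x)); auto.
      apply is_derive_unique; auto_derive;
        [ex_derive_smooth (smooth_on_derive_t D) | unfold dt; ring]. }
    assert (G1x : dx g1 t x = - dx B t x - (dx A t x * b t x + A t x * dx b t x)).
    { rewrite (dx_ext_on D g1 (fun t x => - B t x - A t x * b t x)); auto.
      apply is_derive_unique; auto_derive;
        [ex_derive_smooth (smooth_on_derive_x D) | unfold dx; ring]. }
    assert (Gt : dt G t x = dt A t x * e t x + A t x * dt e t x).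
    { rewrite (dt_ext_on D G (fun t x => A t x * e t x)); auto.
      apply is_derive_unique; auto_derive;
        [ex_derive_smooth (smooth_on_derive_t D) | unfold dt; ring]. }
    assert (Gx : dx G t x = dx A t x * e t x + A t x * dx e t x).
    { rewrite (dx_ext_on D G (fun t x => A t x * e t x)); auto.
      apply is_derive_unique; auto_derive;
        [ex_derive_smooth (smooth_on_derive_x D) | unfold dx; ring]. }
    intros [] y; unfold aff, P, p, Q, q.
    (* The row of v is an identity, by the very construction of the second row of [Q]. *)
    + rewrite !Zc, EQ; unfold Qft, Qff, qf; ring.
    + rewrite EQft, EQff, Eqf; unfold Qft, Qff, qf.
      specialize (HA t x Hp); specialize (R1 t x Hp); specialize (R2 t x Hp).
      specialize (R3 t x Hp).
      apply (Rmult_eq_reg_l (A t x)); auto.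
      apply Rminus_diag_uniq.
      (* The row of v_x, multiplied by [A], is the integrability condition with independent values
         [y true] and [y false] for v and v_x. *)
      transitivity (- (res1 A B g1 g2 t x * y false - res2 A B C g1 g2 t x * y true
        - res3 A B C g1 G t x)); [| rewrite R1, R2, R3; ring].
      unfold res1, res2, res3, coupling.
      rewrite G2t, G1t, Gt, G2x, G1x, Gx, (Ea t x Hp), (Eb t x Hp), (Ee t x Hp).
      field; auto.
  - exists d, (u true).
    assert (HO := open_box t0 x0 d).
    assert (Hp : box t0 x0 d (t0, x0))
      by (split; simpl; rewrite Rminus_diag, Rabs_R0; auto).
    assert (Vx : forall t x, box t0 x0 d (t, x) -> dx (u true) t x = u false t x).
    { intros t x Hq; apply is_derive_unique.
      replace (u false t x) with (aff2 (P true) (p true) u t x)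
        by (unfold aff2, aff, P, p; ring).
      apply Du; auto. }
    split; [auto|]; split; [auto|]; split; [auto|]; split; [auto|].
    split; [rewrite Vx; auto|].
    intros t x Hq; split.
    + rewrite Vx by auto; transitivity (aff2 (Q true) (q true) u t x).
      * apply is_derive_unique; apply Du; auto.
      * unfold aff2, aff, Q, q; ring.
    + rewrite (dx_ext_on (box t0 x0 d) (dx (u true)) (u false)) by auto.
      rewrite Vx by auto.
      replace (dx (u false) t x) with (aff2 (P false) (p false) u t x)
        by (symmetry; apply is_derive_unique; apply Du; auto).
      unfold aff2, aff, P, p.
      rewrite (Ea t x), (Eb t x), (Ee t x) by auto; ring.
Qed.

Lemma box_sub t0 x0 d d' z : d <= d' -> box t0 x0 d z -> box t0 x0 d' z.
Proof. intros Hd [H1 H2]; split; lra. Qed.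

Lemma lax_pair_linear A B C g1 g2 G v t x :
  lax_pair A B C g1 g2 G v t x -> linear_eq A B C v t x.
Proof. intros [H1 H2]; unfold linear_eq; lra. Qed.

Lemma lax_pair_transformation A B C g1 g2 g3 v1 v2 v3 t x :
  A t x <> 0 -> wronskian v1 v2 t x <> 0 ->
  lax_pair A B C g1 g2 (fun _ _ => 0) v1 t x ->
  lax_pair A B C g1 g2 (fun _ _ => 0) v2 t x ->
  lax_pair A B C g1 g2 g3 v3 t x ->
  transformation A B C v1 v2 v3 g1 g2 g3 t x.
Proof.
  intros HA HW [_ M1] [_ M2] [_ M3].
  assert (X : forall w r, A t x * w = r -> w = r / A t x)
    by (intros w r <-; field; auto).
  apply X in M1, M2, M3; unfold transformation, wronskian, det3 in *.
  rewrite M1, M2, M3; repeat split; field; auto.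
Qed.

(** A relation valid on the open set can be differentiated in [x]; at the given point this yields
    two equations for [a] and [b] with the Wronskian as determinant. *)
Lemma wronskian_lin_indep D v1 v2 t0 x0 :
  open D -> D (t0, x0) -> smooth_on D v1 -> smooth_on D v2 ->
  wronskian v1 v2 t0 x0 <> 0 -> lin_indep_on D v1 v2.
Proof.
  intros HD Hp S1 S2 HW a b Hab.
  assert (E0 := Hab t0 x0 Hp).
  assert (E1 : a * dx v1 t0 x0 + b * dx v2 t0 x0 = 0).
  { transitivity (dx (fun t x => a * v1 t x + b * v2 t x) t0 x0).
    - symmetry; apply is_derive_unique; auto_derive;
        [ex_derive_smooth (smooth_on_derive_x D) | unfold dx; ring].
    - rewrite (dx_ext_on D _ (fun _ _ => 0)); auto; apply (Derive_const 0). }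
  split; apply (Rmult_eq_reg_r (wronskian v1 v2 t0 x0)); auto;
    rewrite Rmult_0_l; unfold wronskian.
  - transitivity (dx v2 t0 x0 * (a * v1 t0 x0 + b * v2 t0 x0)
      - v2 t0 x0 * (a * dx v1 t0 x0 + b * dx v2 t0 x0)); [ring|].
    rewrite E0, E1; ring.
  - transitivity (v1 t0 x0 * (a * dx v1 t0 x0 + b * dx v2 t0 x0)
      - dx v1 t0 x0 * (a * v1 t0 x0 + b * v2 t0 x0)); [ring|].
    rewrite E0, E1; ring.
Qed.

Lemma nonlinear_represented D A B C g1 g2 g3 :
  open D -> smooth_on D A -> smooth_on D B -> smooth_on D C ->
  smooth_on D g1 -> smooth_on D g2 -> smooth_on D g3 ->
  (forall t x, D (t, x) -> A t x <> 0) ->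
  (forall t x, D (t, x) -> nonlinear_system A B C g1 g2 g3 t x) ->
  locally_represented D A B C g1 g2 g3.
Proof.
  intros HD SA SB SC S1 S2 S3 HA HN [t0 x0] Hp.
  assert (R1 : forall t x, D (t, x) -> res1 A B g1 g2 t x = 0)
    by (intros t x Hq; apply (HN t x Hq)).
  assert (R2 : forall t x, D (t, x) -> res2 A B C g1 g2 t x = 0)
    by (intros t x Hq; apply (HN t x Hq)).
  assert (R3 : forall t x, D (t, x) -> res3 A B C g1 g3 t x = 0)
    by (intros t x Hq; apply (HN t x Hq)).
  assert (S0 : smooth_on D (fun _ _ => 0)) by (apply smooth_on_const; auto).
  assert (R0 : forall t x, D (t, x) -> res3 A B C g1 (fun _ _ => 0) t x = 0)
    by (intros; apply res3_zero).
  (* The data (1, 0) and (0, 1) for (v, v_x) make the Wronskian of [v1] and [v2] equal to 1 at the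
     point; [v3] is a particular solution with zero data. *)
  destruct (lax_pair_solution D A B C g1 g2 (fun _ _ => 0) t0 x0
    (fun i => if i then 1 else 0)) as (d1 & v1 & Hd1 & HB1 & Sv1 & V1 & W1 & L1); auto.
  destruct (lax_pair_solution D A B C g1 g2 (fun _ _ => 0) t0 x0
    (fun i => if i then 0 else 1)) as (d2 & v2 & Hd2 & HB2 & Sv2 & V2 & W2 & L2); auto.
  destruct (lax_pair_solution D A B C g1 g2 g3 t0 x0
    (fun _ => 0)) as (d3 & v3 & Hd3 & HB3 & Sv3 & _ & _ & L3); auto.
  assert (HW0 : wronskian v1 v2 t0 x0 <> 0)
    by (unfold wronskian; rewrite V1, V2, W1, W2; lra).
  assert (P0 : forall d, 0 < d -> box t0 x0 d (t0, x0))
    by (intros d Hd; split; simpl; rewrite Rminus_diag, Rabs_R0; auto).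
  assert (HW : locally_2d (fun t x => wronskian v1 v2 t x <> 0) t0 x0).
  { apply continuity_2d_pt_neq_0; auto; unfold wronskian.
    apply continuity_2d_pt_minus; apply continuity_2d_pt_mult;
      eapply smooth_on_continuity; eauto using smooth_on_dx. }
  destruct HW as [dW HW].
  (* A common box for the three solutions on which, by continuity, the Wronskian keeps away from
     zero. *)
  set (d := Rmin (Rmin d1 d2) (Rmin d3 dW)).
  assert (Hd : 0 < d) by (repeat apply Rmin_pos; auto; apply cond_pos).
  assert (Dd1 : d <= d1) by (eapply Rle_trans; [apply Rmin_l | apply Rmin_l]).
  assert (Dd2 : d <= d2) by (eapply Rle_trans; [apply Rmin_l | apply Rmin_r]).
  assert (Dd3 : d <= d3) by (eapply Rle_trans; [apply Rmin_r | apply Rmin_l]).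
  assert (DdW : d <= dW) by (eapply Rle_trans; [apply Rmin_r | apply Rmin_r]).
  clearbody d.
  exists (box t0 x0 d); split; [apply open_box|]; split; [auto|].
  split; [intros z Hz; apply HB1; apply (box_sub t0 x0 d); auto|].
  assert (Sb1 : smooth_on (box t0 x0 d) v1)
    by (apply (smooth_on_sub (box t0 x0 d1)); auto; intros; apply (box_sub _ _ d); auto).
  assert (Sb2 : smooth_on (box t0 x0 d) v2)
    by (apply (smooth_on_sub (box t0 x0 d2)); auto; intros; apply (box_sub _ _ d); auto).
  assert (Sb3 : smooth_on (box t0 x0 d) v3)
    by (apply (smooth_on_sub (box t0 x0 d3)); auto; intros; apply (box_sub _ _ d); auto).
  exists v1, v2, v3; repeat (split; [assumption|]).
  split; [apply (wronskian_lin_indep _ v1 v2 t0 x0); auto; apply open_box|].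
  intros t x Hq.
  assert (M1 := L1 t x (box_sub _ _ _ _ _ Dd1 Hq)).
  assert (M2 := L2 t x (box_sub _ _ _ _ _ Dd2 Hq)).
  assert (M3 := L3 t x (box_sub _ _ _ _ _ Dd3 Hq)).
  assert (HWq : wronskian v1 v2 t x <> 0)
    by (destruct Hq as [Ht Hx]; simpl in Ht, Hx; apply HW; lra).
  assert (HAq : A t x <> 0) by (apply HA, HB1, (box_sub t0 x0 d); auto).
  split; [auto|].
  repeat (split; [eapply lax_pair_linear; eassumption|]).
  apply lax_pair_transformation; auto.
Qed.

Theorem corollary5 :
  forall (D : R * R -> Prop) (A B C g1 g2 g3 : R -> R -> R),
    open D ->
    analytic_on D A -> analytic_on D B -> analytic_on D C ->
    (forall t x : R, D (t, x) -> A t x <> 0) ->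
    smooth_on D g1 -> smooth_on D g2 -> smooth_on D g3 ->
    (forall t x : R, D (t, x) -> nonlinear_system A B C g1 g2 g3 t x) <->
    locally_represented D A B C g1 g2 g3.
Proof.
  intros D A B C g1 g2 g3 HD HA HB HC HA0 S1 S2 S3.
  apply analytic_on_smooth in HA, HB, HC.
  split; intros H.
  - apply nonlinear_represented; auto.
  (* The nonlinear system at a point involves only germs there, so the neighbourhood attached to
     that point suffices. *)
  - intros t x Hp; destruct (H (t, x) Hp) as (U & HU & Up & UD & HR).
    apply (represented_nonlinear U); auto; eauto using smooth_on_sub.
Qed.
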